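(* Let $\Bbbk$ be an algebraically closed field of characteristic zero, let $H$ be an affine Hopf algebra over $\Bbbk$, and let $C$ be a central Hopf subalgebra of $H$ such that $H$ is a finitely generated $C$-module. Then the following hold. (1) As a $C$-module, $H$ is a finitely generated projective module of constant rank, say $d$. (2) $(H,C,\mathrm{tr}_{HS})$ is a Cayley-Hamilton Hopf algebra of degree $d$, where $\mathrm{tr}_{HS}:H\to C$ is the Hattori-Stallings trace map of $H$ viewed as a projective $C$-module.
   Context: Affine means finitely generated as an algebra. Algebra with trace: a triple $(A,C,\mathrm{tr})$ where $A$ is a $\Bbbk$-algebra, $C$ a central subalgebra and $\mathrm{tr}:A\to C$ a $C$-linear map with $\mathrm{tr}(ab)=\mathrm{tr}(ba)$ for all $a,b\in A$. For $a\in A$ and $k\ge 1$ define $c_k(a)=\frac{1}{k!}\det M_k(a)\in C$, where $M_k(a)$ is the $k\times k$ matrix with entries $(M_k)_{ij}=\mathrm{tr}(a^{i-j+1})$ for $j\le i$, $(M_k)_{i,i+1}=i$, and $0$ for $j>i+1$ (so that for matrices over a commutative algebra with the usual trace, $c_k$ gives the usual coefficients of the characteristic polynomial). The $n$-th characteristic polynomial of $a$ is $p_{n,a}(t)=t^n-c_1(a)t^{n-1}+\cdots+(-1)^n c_n(a)\in C[t]$. $(A,C,\mathrm{tr})$ is a Cayley-Hamilton algebra of degree $n$ if $p_{n,a}(a)=0$ for all $a\in A$ and $\mathrm{tr}(1)=n$. A Cayley-Hamilton Hopf algebra is a Cayley-Hamilton algebra $(H,C,\mathrm{tr})$ such that $H$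 is a Hopf algebra and $C$ is a central Hopf subalgebra of $H$. Hattori-Stallings trace: if $A$ is a finitely generated projective $C$-module with dual basis $x_1,\dots,x_n\in A$, $x_1^*,\dots,x_n^*\in\mathrm{Hom}_C(A,C)$ (i.e. $a=\sum_i x_i^*(a)x_i$ for all $a$), then $\mathrm{tr}_{HS}(a)=\sum_{i=1}^n x_i^*(ax_i)$; this is a trace map independent of the choice of dual basis. *)

(* Defs.v *)
From HB Require Import structures.
From mathcomp Require Import all_boot all_algebra.
From mathcomp Require Import generic_quotient ring_quotient.
From mathcomp Require Import boolp ring.

Set Implicit Arguments.
Unset Strict Implicit.
Unset Printing Implicit Defensive.

Import GRing.Theory.
Local Open Scope ring_scope.
Local Open Scope quotient_scope.

(* Tensor products.  The tensor product of U and V over R is the set of formal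
   sums of pairs (u, v), encoded as sequences, two of them being identified
   when every bilinear map gives them the same value.  Scalars and signs need
   no separate generators since a (u (x) v) = (a u) (x) v.  The universal
   property is given by tens_lift_linear, tens_liftE and tens_lift_uniq. *)

Definition bilinear_map (R : comNzRingType) (U V W : lmodType R)
    (f : U -> V -> W) : Prop :=
  (forall v, linear (f^~ v)) /\ (forall u, linear (f u)).

Section TensorType.
Variables (R : comNzRingType) (U V : lmodType R).
Implicit Types s t : seq (U * V).

Definition tens_sum (W : nmodType) (f : U -> V -> W) s : W :=
  \sum_(p <- s) f p.1 p.2.

Definition tens_equiv : rel (seq (U * V)) := fun s t =>
  `[< forall (W : lmodType R) (f : U -> V -> W),
        bilinear_map f -> tens_sum f s = tens_sum f t >].

Lemma tens_equivP s t :
  reflect (forall (W : lmodType R) (f : U -> V -> W),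
             bilinear_map f -> tens_sum f s = tens_sum f t) (tens_equiv s t).
Proof. exact: asboolP. Qed.

Lemma tens_equiv_refl : reflexive tens_equiv.
Proof. by move=> s; apply/tens_equivP. Qed.

Lemma tens_equiv_sym : symmetric tens_equiv.
Proof.
by move=> s t; apply/tens_equivP/tens_equivP => e W f bf; rewrite e.
Qed.

Lemma tens_equiv_trans : transitive tens_equiv.
Proof.
move=> t s u /tens_equivP e1 /tens_equivP e2.
by apply/tens_equivP => W f bf; rewrite e1 // e2.
Qed.

Canonical tens_equiv_rel :=
  EquivRel tens_equiv tens_equiv_refl tens_equiv_sym tens_equiv_trans.

Definition tensor : Type := {eq_quot tens_equiv}.
HB.instance Definition _ : EqQuotient _ tens_equiv tensor :=
  EqQuotient.on tensor.
HB.instance Definition _ := Choice.on tensor.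

Definition tens (u : U) (v : V) : tensor := \pi_tensor [:: (u, v)].

Lemma tens_piP s t :
  (forall (W : lmodType R) (f : U -> V -> W),
     bilinear_map f -> tens_sum f s = tens_sum f t) ->
  \pi_tensor s = \pi_tensor t.
Proof. by move=> e; apply/eqmodP/tens_equivP. Qed.

Lemma tens_sum_repr (W : lmodType R) (f : U -> V -> W) s :
  bilinear_map f -> tens_sum f (repr (\pi_tensor s)) = tens_sum f s.
Proof.
move=> bf; suff /tens_equivP : tens_equiv (repr (\pi_tensor s)) s by apply.
by apply/eqmodP; rewrite reprK.
Qed.

Definition tens_lift (W : nmodType) (f : U -> V -> W) (x : tensor) : W :=
  tens_sum f (repr x).

Definition tens_zero : tensor := \pi_tensor [::].
Definition tens_opp (x : tensor) : tensor :=
  \pi_tensor [seq (- p.1, p.2) | p <- repr x].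
Definition tens_add (x y : tensor) : tensor := \pi_tensor (repr x ++ repr y).
Definition tens_scale (a : R) (x : tensor) : tensor :=
  \pi_tensor [seq (a *: p.1, p.2) | p <- repr x].

Section BilinearSum.
Variables (W : lmodType R) (f : U -> V -> W).
Hypothesis bf : bilinear_map f.

Let f0l v : f 0 v = 0.
Proof. by have := bf.1 v (-1) 0 0; rewrite scaler0 addr0 scaleN1r addNr. Qed.
Let fZl a u v : f (a *: u) v = a *: f u v.
Proof. by have := bf.1 v a u 0; rewrite !addr0 f0l addr0. Qed.

Lemma tens_sum1 u v : tens_sum f [:: (u, v)] = f u v.
Proof. exact: big_seq1. Qed.

Lemma tens_sum_cat s t : tens_sum f (s ++ t) = tens_sum f s + tens_sum f t.
Proof. exact: big_cat. Qed.

Lemma tens_sum_scale a s :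
  tens_sum f [seq (a *: p.1, p.2) | p <- s] = a *: tens_sum f s.
Proof.
rewrite /tens_sum big_map scaler_sumr.
by apply: eq_bigr => p _; rewrite fZl.
Qed.

Lemma tens_sum_opp s : tens_sum f [seq (- p.1, p.2) | p <- s] = - tens_sum f s.
Proof.
rewrite -scaleN1r -tens_sum_scale /tens_sum !big_map.
by apply: eq_bigr => p _; rewrite scaleN1r.
Qed.

End BilinearSum.

Let tens_sumE :=
  (tens_sum_cat, tens_sum_repr, tens_sum1, tens_sum_opp, tens_sum_scale).

Fact tens_addA : associative tens_add.
Proof.
by move=> x y z; apply: tens_piP => W f bf; rewrite !tens_sumE // addrA.
Qed.

Fact tens_addC : commutative tens_add.
Proof.
by move=> x y; apply: tens_piP => W f bf; rewrite !tens_sumE // addrC.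
Qed.

Fact tens_add0 : left_id tens_zero tens_add.
Proof.
move=> x; rewrite -[RHS]reprK; apply: tens_piP => W f bf.
by rewrite !tens_sumE // /tens_sum big_nil add0r.
Qed.

Fact tens_addN : left_inverse tens_zero tens_opp tens_add.
Proof.
move=> x; apply: tens_piP => W f bf.
by rewrite !tens_sumE // [in RHS]/tens_sum big_nil addNr.
Qed.

HB.instance Definition _ := GRing.isZmodule.Build tensor
  tens_addA tens_addC tens_add0 tens_addN.

Fact tens_scaleA a b x : tens_scale a (tens_scale b x) = tens_scale (a * b) x.
Proof. by apply: tens_piP => W f bf; rewrite !tens_sumE // scalerA. Qed.

Fact tens_scale1 : left_id 1 tens_scale.
Proof.
move=> x; rewrite -[RHS]reprK; apply: tens_piP => W f bf.
by rewrite !tens_sumE // scale1r.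
Qed.

Fact tens_scaleDr : right_distributive tens_scale +%R.
Proof.
by move=> a x y; apply: tens_piP => W f bf; rewrite !tens_sumE // scalerDr.
Qed.

Fact tens_scaleDl x : {morph tens_scale^~ x : a b / a + b}.
Proof.
by move=> a b; apply: tens_piP => W f bf; rewrite !tens_sumE // scalerDl.
Qed.

HB.instance Definition _ := GRing.Zmodule_isLmodule.Build R tensor
  tens_scaleA tens_scale1 tens_scaleDr tens_scaleDl.

Lemma tens_bilinear : bilinear_map tens.
Proof.
split=> [v a u u'|u a v v']; apply: tens_piP => W f bf;
  rewrite !tens_sumE //.
- exact: bf.1.
- exact: bf.2.
Qed.

Lemma pi_tens s : \pi_tensor s = \sum_(p <- s) tens p.1 p.2.
Proof.
elim: s => [|[u v] s IHs]; first by rewrite big_nil.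
rewrite big_cons -IHs; apply: tens_piP => W f bf.
by rewrite !tens_sumE // [LHS]big_cons.
Qed.

Lemma tensorE (x : tensor) : x = \sum_(p <- repr x) tens p.1 p.2.
Proof. by rewrite -pi_tens reprK. Qed.

Lemma tens_lift_linear (W : lmodType R) (f : U -> V -> W) :
  bilinear_map f -> linear (tens_lift f).
Proof. by move=> bf a x y; rewrite /tens_lift !tens_sumE. Qed.

Lemma tens_liftE (W : lmodType R) (f : U -> V -> W) :
  bilinear_map f -> forall u v, tens_lift f (tens u v) = f u v.
Proof.
by move=> bf u v; rewrite /tens_lift !tens_sumE.
Qed.

Lemma tens_lift_uniq (W : lmodType R) (f : U -> V -> W)
    (g : {linear tensor -> W}) :
  (forall u v, g (tens u v) = f u v) -> g =1 tens_lift f.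
Proof.
move=> gE x; rewrite {1}[x]tensorE linear_sum.
by apply: eq_bigr => p _; rewrite gE.
Qed.

End TensorType.

Section TensorMaps.
Variable R : comNzRingType.

Definition tens_map (U V U' V' : lmodType R) (f : U -> U') (g : V -> V') :
    tensor U V -> tensor U' V' :=
  tens_lift (fun u v => tens (f u) (g v)).

Definition tens_assoc (U V W : lmodType R) :
    tensor (tensor U V) W -> tensor U (tensor V W) :=
  tens_lift (fun x w => tens_lift (fun u v => tens u (tens v w)) x).

End TensorMaps.

Section TensorAlgebra.
Variables (R : comNzRingType) (A B : algType R).
Implicit Types s t : seq (A * B).

Definition tens_one : tensor A B := tens 1 1.
Definition tens_seq_mul s t : seq (A * B) :=
  [seq (p.1 * q.1, p.2 * q.2) | p <- s, q <- t].
Definition tens_mul (x y : tensor A B) : tensor A B :=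
  \pi_(tensor A B) (tens_seq_mul (repr x) (repr y)).

Lemma bilinear_mull (W : lmodType R) (f : A -> B -> W) a b :
  bilinear_map f -> bilinear_map (fun x y => f (a * x) (b * y)).
Proof.
by move=> bf; split=> [y|x] c u v /=;
  rewrite mulrDr -scalerAr ?bf.1 ?bf.2.
Qed.

Lemma bilinear_mulr (W : lmodType R) (f : A -> B -> W) a b :
  bilinear_map f -> bilinear_map (fun x y => f (x * a) (y * b)).
Proof.
by move=> bf; split=> [y|x] c u v /=;
  rewrite mulrDl -scalerAl ?bf.1 ?bf.2.
Qed.

Lemma big_tens_seq_mul (W : nmodType) (F : A * B -> W) s t :
  \sum_(r <- tens_seq_mul s t) F r =
  \sum_(p <- s) \sum_(q <- t) F (p.1 * q.1, p.2 * q.2).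
Proof. by rewrite /tens_seq_mul big_allpairs_dep. Qed.

Lemma tens_sum_mul (W : nmodType) (f : A -> B -> W) s t :
  tens_sum f (tens_seq_mul s t) =
  \sum_(p <- s) \sum_(q <- t) f (p.1 * q.1) (p.2 * q.2).
Proof. exact: big_tens_seq_mul. Qed.

Lemma tens_mul_pi s t :
  tens_mul (\pi_(tensor A B) s) (\pi_(tensor A B) t) =
  \pi_(tensor A B) (tens_seq_mul s t).
Proof.
apply: tens_piP => W f bf; rewrite !tens_sum_mul.
under eq_bigr => p _.
  have := tens_sum_repr t (bilinear_mull p.1 p.2 bf).
  rewrite /tens_sum => ->; over.
rewrite exchange_big [RHS]exchange_big /=; apply: eq_bigr => q _.
exact: (tens_sum_repr s (bilinear_mulr q.1 q.2 bf)).
Qed.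

Lemma tens_mulE a b a' b' :
  tens_mul (tens a b) (tens a' b') = tens (a * a') (b * b').
Proof. by rewrite tens_mul_pi. Qed.

Fact tens_mulA : associative tens_mul.
Proof.
move=> x y z; rewrite -[x]reprK -[y]reprK -[z]reprK.
move: (repr x) (repr y) (repr z) => s t u.
rewrite (tens_mul_pi t u) (tens_mul_pi s t) !tens_mul_pi.
apply: tens_piP => W f bf; rewrite !tens_sum_mul.
rewrite [in RHS]big_tens_seq_mul; apply: eq_bigr => p _.
rewrite big_tens_seq_mul; apply: eq_bigr => q _; apply: eq_bigr => r _ /=.
by rewrite !mulrA.
Qed.

Fact tens_mul1x : left_id tens_one tens_mul.
Proof.
move=> x; rewrite -[x]reprK /tens_one /tens tens_mul_pi.
apply: tens_piP => W f bf; rewrite tens_sum_mul big_seq1.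
by apply: eq_bigr => p _; rewrite !mul1r.
Qed.

Fact tens_mulx1 : right_id tens_one tens_mul.
Proof.
move=> x; rewrite -[x]reprK /tens_one /tens tens_mul_pi.
apply: tens_piP => W f bf; rewrite tens_sum_mul.
by apply: eq_bigr => p _; rewrite big_seq1 !mulr1.
Qed.

Lemma pi_tens_cat s t :
  \pi_(tensor A B) s + \pi_(tensor A B) t = \pi_(tensor A B) (s ++ t).
Proof. by rewrite !pi_tens big_cat. Qed.

Fact tens_mulDl : left_distributive tens_mul +%R.
Proof.
move=> x y z; rewrite -[x]reprK -[y]reprK -[z]reprK.
move: (repr x) (repr y) (repr z) => s t u.
rewrite (pi_tens_cat s t) (tens_mul_pi s u) (tens_mul_pi t u) tens_mul_pi.
rewrite pi_tens_cat; apply: tens_piP => W f bf.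
by rewrite tens_sum_cat !tens_sum_mul big_cat.
Qed.

Fact tens_mulDr : right_distributive tens_mul +%R.
Proof.
move=> x y z; rewrite -[x]reprK -[y]reprK -[z]reprK.
move: (repr x) (repr y) (repr z) => s t u.
rewrite (pi_tens_cat t u) (tens_mul_pi s t) (tens_mul_pi s u) tens_mul_pi.
rewrite pi_tens_cat.
apply: tens_piP => W f bf.
rewrite tens_sum_cat !tens_sum_mul -big_split.
by apply: eq_bigr => p _; rewrite big_cat.
Qed.

HB.instance Definition _ := GRing.Zmodule_isPzRing.Build (tensor A B)
  tens_mulA tens_mul1x tens_mulx1 tens_mulDl tens_mulDr.

End TensorAlgebra.

HB.mixin Record Algebra_isHopf (k : fieldType) H of GRing.Algebra k H := {
  comul : {lrmorphism H -> tensor H H};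
  counit : {lrmorphism H -> k^o};
  antipode : {linear H -> H};
  comulA : forall h : H,
    tens_assoc (tens_map comul id (comul h)) = tens_map id comul (comul h);
  counitl : forall h : H, tens_lift (fun a b => counit a *: b) (comul h) = h;
  counitr : forall h : H, tens_lift (fun a b => counit b *: a) (comul h) = h;
  antipodel : forall h : H,
    tens_lift (fun a b => antipode a * b) (comul h) = (counit h)%:A;
  antipoder : forall h : H,
    tens_lift (fun a b => a * antipode b) (comul h) = (counit h)%:A
}.

#[short(type="hopfAlgType")]
HB.structure Definition HopfAlgebra (k : fieldType) :=
  {H of Algebra_isHopf k H & GRing.Algebra k H}.

Definition affine_algebra (R : nzRingType) (A : algType R) : Prop :=
  exists X : seq A, forall S : {pred A},
    subalg_closed S -> {subset X <= S} -> forall a : A, a \in S.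

HB.mixin Record isCentral (A : nzRingType) (S : {pred A}) := {
  central_subproof : forall c a : A, c \in S -> c * a = a * c
}.

#[short(type="centralSubalg")]
HB.structure Definition CentralSubalg (R : nzRingType) (A : algType R) :=
  {S of GRing.SemiringClosed A S & GRing.isScaleClosed R A S & isCentral A S}.

(* A regarded as a module over C *)
Definition over_csub (R : nzRingType) (A : algType R) (C : centralSubalg A) :
  Type := A.

Section CentralSubalgebra.
Variables (R : nzRingType) (A : algType R) (C : centralSubalg A).

Definition csub : Type := {x : A | x \in (C : {pred A})}.

HB.instance Definition _ := SubChoice.on csub.
HB.instance Definition _ := [SubChoice_isSubAlgebra of csub by <:].

Fact csub_mulC : @commutative csub csub *%R.
Proof. by move=> x y; apply/val_inj/(central_subproof (s := C))/(valP x). Qed.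

HB.instance Definition _ := GRing.PzRing_hasCommutativeMul.Build csub csub_mulC.

HB.instance Definition _ := GRing.Zmodule.copy (over_csub C) A.

Definition csub_scale (c : csub) (a : over_csub C) : over_csub C :=
  (val c * (a : A) : A).

Fact csub_scaleA c c' a :
  csub_scale c (csub_scale c' a) = csub_scale (c * c') a.
Proof. exact: mulrA. Qed.
Fact csub_scale1 : left_id 1 csub_scale.
Proof. exact: mul1r. Qed.
Fact csub_scaleDr : right_distributive csub_scale +%R.
Proof. by move=> c a b; exact: (@mulrDr A). Qed.
Fact csub_scaleDl a : {morph csub_scale^~ a : c c' / c + c'}.
Proof. by move=> c c'; exact: (@mulrDl A). Qed.

HB.instance Definition _ := GRing.Zmodule_isLmodule.Build csub (over_csub C)
  csub_scaleA csub_scale1 csub_scaleDr csub_scaleDl.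

End CentralSubalgebra.

(* The condition comul(C) <= C (x) C, the latter seen inside H (x) H. *)
Definition hopf_subalgebra (k : fieldType) (H : hopfAlgType k)
    (C : centralSubalg H) : Prop :=
  (forall c : csub C, exists s : seq (csub C * csub C),
     comul (val c) = \sum_(p <- s) tens (val p.1) (val p.2)) /\
  (forall c : csub C, antipode (val c) \in (C : {pred H})).

Section Modules.
Variable R : comNzRingType.

Definition finitely_generated (M : lmodType R) : Prop :=
  exists (n : nat) (x : 'I_n -> M),
    forall m, exists c : 'I_n -> R, m = \sum_i c i *: x i.

Definition projective (M : lmodType R) : Prop :=
  forall (N P : lmodType R) (g : {linear N -> P}) (f : {linear M -> P}),
    (forall p, exists n, g n = p) ->
    exists h : {linear M -> N}, forall m, g (h m) = f m.

Definition free_of_rank (M : lmodType R) (d : nat) : Prop :=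
  exists e : 'I_d -> M,
    forall m, exists! c : {ffun 'I_d -> R}, m = \sum_i c i *: e i.

Record dual_basis (M : lmodType R) := DualBasis {
  db_size : nat;
  db_vec : 'I_db_size -> M;
  db_coord : 'I_db_size -> {linear M -> R^o};
  db_expand : forall m, m = \sum_i db_coord i m *: db_vec i
}.

Lemma dual_basis_exists (M : lmodType R) :
  finitely_generated M -> projective M -> inhabited (dual_basis M).
Proof.
move=> [n [x gen]] proj.
pose g (r : 'rV[R]_n) : M := \sum_i r 0 i *: x i.
have g_lin : linear g.
  move=> a r s; rewrite /g scaler_sumr -big_split /=; apply: eq_bigr => i _.
  by rewrite !mxE scalerDl scalerA.
pose gL := GRing.isLinear.Build R 'rV[R]_n M *:%R g g_lin.
pose gl : {linear 'rV[R]_n -> M} := HB.pack g gL.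
have gsurj p : exists r, gl r = p.
  have [c ->] := gen p; exists (\row_i c i).
  by apply: eq_bigr => i _; rewrite mxE.
have [h hE] := proj _ _ gl idfun gsurj.
pose co i (m : M) : R^o := h m 0 i.
have co_lin i : linear (co i) by move=> a u v; rewrite /co linearP !mxE.
pose coL i := GRing.isLinear.Build R M R^o *:%R (co i) (co_lin i).
pose col i : {linear M -> R^o} := HB.pack (co i) (coL i).
constructor; exists n x col => m.
by rewrite -[LHS](hE m).
Qed.

End Modules.

(* Localization at a prime ideal: fractions x / s with s outside P. *)
Section Localization.
Variables (R : comNzRingType) (P : prime_idealr R).

Definition denom : Type := {s : R | s \notin (P : {pred R})}.
HB.instance Definition _ := SubChoice.on denom.

Fact denom1_subproof : 1 \notin (P : {pred R}).
Proof. by rewrite idealr1. Qed.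
Definition denom1 : denom := exist _ 1 denom1_subproof.

Fact denomM_subproof (s t : denom) : val s * val t \notin (P : {pred R}).
Proof. by rewrite prime_idealrM negb_or (valP s) (valP t). Qed.
Definition denomM (s t : denom) : denom :=
  exist _ (val s * val t) (denomM_subproof s t).

Section Module.
Variable M : lmodType R.

Definition frac_equiv : rel (M * denom) := fun x y =>
  `[< exists u : denom,
        val u *: (val y.2 *: x.1) = val u *: (val x.2 *: y.1) >].

Lemma frac_equivP (x y : M * denom) :
  reflect (exists u : denom,
             val u *: (val y.2 *: x.1) = val u *: (val x.2 *: y.1))
          (frac_equiv x y).
Proof. exact: asboolP. Qed.

Lemma frac_equiv_refl : reflexive frac_equiv.
Proof. by move=> x; apply/frac_equivP; exists denom1. Qed.

Lemma frac_equiv_sym : symmetric frac_equiv.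
Proof.
by move=> x y; apply/frac_equivP/frac_equivP => -[u e]; exists u.
Qed.

Lemma frac_equiv_trans : transitive frac_equiv.
Proof.
move=> [y t] [x s] [z r] /frac_equivP[u /= e] /frac_equivP[v /= f].
apply/frac_equivP; exists (denomM (denomM u v) t) => /=.
have -> : val u * val v * val t *: (val r *: x) =
          (val v * val r) *: (val u *: (val t *: x)).
  by rewrite !scalerA; congr (_ *: _) => /=; ring.
have -> : val u * val v * val t *: (val s *: z) =
          (val u * val s) *: (val v *: (val t *: z)).
  by rewrite !scalerA; congr (_ *: _) => /=; ring.
by rewrite e -f !scalerA; congr (_ *: _) => /=; ring.
Qed.

Canonical frac_equiv_rel :=
  EquivRel frac_equiv frac_equiv_refl frac_equiv_sym frac_equiv_trans.

Definition loc_mod : Type := {eq_quot frac_equiv}.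
HB.instance Definition _ : EqQuotient _ frac_equiv loc_mod :=
  EqQuotient.on loc_mod.
HB.instance Definition _ := Choice.on loc_mod.

Definition frac (x : M) (s : denom) : loc_mod := \pi_loc_mod (x, s).

Lemma fracP x s y t :
  frac x s = frac y t <->
  exists u : denom, val u *: (val t *: x) = val u *: (val s *: y).
Proof.
split; first by move=> /eqmodP/frac_equivP.
by move=> e; apply/eqmodP/frac_equivP.
Qed.

Lemma frac_eq x s y t : val t *: x = val s *: y -> frac x s = frac y t.
Proof. by move=> e; apply/fracP; exists denom1; rewrite e. Qed.

Lemma fracE (q : loc_mod) : frac (repr q).1 (repr q).2 = q.
Proof. by rewrite /frac -surjective_pairing reprK. Qed.

Definition loc_zero : loc_mod := frac 0 denom1.
Definition loc_opp (q : loc_mod) : loc_mod := frac (- (repr q).1) (repr q).2.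
Definition loc_add (p q : loc_mod) : loc_mod :=
  let x := repr p in let y := repr q in
  frac (val y.2 *: x.1 + val x.2 *: y.1) (denomM x.2 y.2).

Lemma loc_oppE x s : loc_opp (frac x s) = frac (- x) s.
Proof.
have := fracE (frac x s); rewrite /loc_opp; case: (repr _) => y t /= /fracP[u e].
by apply/fracP; exists u; rewrite !scalerN e.
Qed.

Lemma loc_addE x s y t :
  loc_add (frac x s) (frac y t) =
  frac (val t *: x + val s *: y) (denomM s t).
Proof.
have := fracE (frac x s); have := fracE (frac y t); rewrite /loc_add.
case: (repr (frac x s)) (repr (frac y t)) => x' s' [y' t'] /=.
move=> /fracP[v f] /fracP[u e]; apply/fracP; exists (denomM u v) => /=.
rewrite !scalerDr; congr (_ + _).
  transitivity ((val v * val t * val t') *: (val u *: (val s *: x'))).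
    by rewrite !scalerA; congr (_ *: _) => /=; ring.
  by rewrite e !scalerA; congr (_ *: _) => /=; ring.
transitivity ((val u * val s * val s') *: (val v *: (val t *: y'))).
  by rewrite !scalerA; congr (_ *: _) => /=; ring.
by rewrite f !scalerA; congr (_ *: _) => /=; ring.
Qed.

Fact loc_addA : associative loc_add.
Proof.
move=> p q r; rewrite -[p]fracE -[q]fracE -[r]fracE !loc_addE.
apply: frac_eq => /=; rewrite !scalerDr !scalerA addrA.
by congr (_ *: _ + _ *: _ + _ *: _) => /=; ring.
Qed.

Fact loc_addC : commutative loc_add.
Proof.
move=> p q; rewrite -[p]fracE -[q]fracE !loc_addE.
apply: frac_eq => /=; rewrite !scalerDr !scalerA addrC.
by congr (_ *: _ + _ *: _) => /=; ring.
Qed.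

Fact loc_add0 : left_id loc_zero loc_add.
Proof.
move=> p; rewrite -[p]fracE loc_addE; apply: frac_eq => /=.
by rewrite scaler0 add0r scale1r mul1r.
Qed.

Fact loc_addN : left_inverse loc_zero loc_opp loc_add.
Proof.
move=> p; rewrite -[p]fracE loc_oppE loc_addE; apply: frac_eq => /=.
by rewrite scalerN addNr !scaler0.
Qed.

HB.instance Definition _ := GRing.isZmodule.Build loc_mod
  loc_addA loc_addC loc_add0 loc_addN.

Lemma frac_add x s y t :
  frac x s + frac y t = frac (val t *: x + val s *: y) (denomM s t).
Proof. exact: loc_addE. Qed.

End Module.

Definition loc_ring : Type := loc_mod R^o.
HB.instance Definition _ := GRing.Zmodule.on loc_ring.

Definition rfrac (a : R) (s : denom) : loc_ring := frac (a : R^o) s.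

Lemma rfracE (q : loc_ring) : rfrac (repr q).1 (repr q).2 = q.
Proof. exact: fracE. Qed.

Lemma rfrac_add a s b t :
  rfrac a s + rfrac b t = rfrac (val t * a + val s * b) (denomM s t).
Proof. exact: frac_add. Qed.

Section Scale.
Variable M : lmodType R.

Definition loc_scale (p : loc_ring) (q : loc_mod M) : loc_mod M :=
  let a := repr p in let x := repr q in
  frac ((a.1 : R) *: x.1) (denomM a.2 x.2).

Lemma loc_scaleE a s x t :
  loc_scale (rfrac a s) (frac x t) = frac (a *: x) (denomM s t).
Proof.
have := rfracE (rfrac a s); have := fracE (frac x t); rewrite /loc_scale.
case: (repr (rfrac a s)) (repr (frac x t)) => a' s' [x' t'] /=.
move=> /fracP[v f] /fracP[u e]; apply/fracP; exists (denomM u v) => /=.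
have {}e : val u * (val s * a') = val u * (val s' * a) by exact: e.
transitivity ((val u * (val s * a')) *: (val v *: (val t *: x'))).
  by rewrite !scalerA; congr (_ *: _) => /=; ring.
by rewrite e f !scalerA; congr (_ *: _) => /=; ring.
Qed.

End Scale.

Definition loc_one : loc_ring := rfrac 1 denom1.
Definition loc_mul (p q : loc_ring) : loc_ring := loc_scale p (q : loc_mod R^o).

Lemma loc_mulE a s b t :
  loc_mul (rfrac a s) (rfrac b t) = rfrac (a * b) (denomM s t).
Proof. exact: loc_scaleE. Qed.

Lemma rfrac_eq a s b t : val t * a = val s * b -> rfrac a s = rfrac b t.
Proof. exact: (@frac_eq R^o). Qed.

Fact loc_mulA : associative loc_mul.
Proof.
move=> p q r; rewrite -[p]rfracE -[q]rfracE -[r]rfracE !loc_mulE.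
by apply: rfrac_eq => /=; ring.
Qed.

Fact loc_mulC : commutative loc_mul.
Proof.
move=> p q; rewrite -[p]rfracE -[q]rfracE !loc_mulE.
by apply: rfrac_eq => /=; ring.
Qed.

Fact loc_mul1 : left_id loc_one loc_mul.
Proof.
move=> p; rewrite -[p]rfracE !loc_mulE.
by apply: rfrac_eq => /=; ring.
Qed.

Fact loc_mulDl : left_distributive loc_mul +%R.
Proof.
move=> p q r; rewrite -[p]rfracE -[q]rfracE -[r]rfracE.
rewrite !(loc_mulE, rfrac_add).
by apply: rfrac_eq => /=; ring.
Qed.

Fact loc_one_neq0 : loc_one != 0.
Proof.
apply/eqP => /fracP[u] /=; rewrite !scaler0 !scale1r => u0.
have /negP := valP u; apply; rewrite -[val u]mulr1.
by rewrite [_ * _]u0 idealr0.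
Qed.

HB.instance Definition _ := GRing.Zmodule_isComNzRing.Build loc_ring
  loc_mulA loc_mulC loc_mul1 loc_mulDl loc_one_neq0.

Section LocLmodule.
Variable M : lmodType R.

Fact loc_scaleA (a b : loc_ring) (q : loc_mod M) :
  loc_scale a (loc_scale b q) = loc_scale (a * b) q.
Proof.
rewrite -[a]rfracE -[b]rfracE -[q]fracE [_ * _]loc_mulE !loc_scaleE.
by apply: frac_eq => /=; rewrite !scalerA; congr (_ *: _) => /=; ring.
Qed.

Fact loc_scale1 : left_id (1 : loc_ring) (@loc_scale M).
Proof.
move=> q; rewrite -[q]fracE (loc_scaleE 1 denom1).
by apply: frac_eq => /=; rewrite scale1r mul1r.
Qed.

Fact loc_scaleDr : right_distributive (@loc_scale M) +%R.
Proof.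
move=> a p q; rewrite -[a]rfracE -[p]fracE -[q]fracE.
rewrite !(loc_scaleE, frac_add); apply: frac_eq => /=.
rewrite !scalerDr !scalerA.
by congr (_ *: _ + _ *: _) => /=; ring.
Qed.

Fact loc_scaleDl (q : loc_mod M) : {morph (@loc_scale M)^~ q : a b / a + b}.
Proof.
move=> a b; rewrite -[a]rfracE -[b]rfracE -[q]fracE.
rewrite !(loc_scaleE, frac_add, rfrac_add); apply: frac_eq => /=.
rewrite scalerDr !scalerA -scalerDl.
by congr (_ *: _) => /=; ring.
Qed.

HB.instance Definition _ := GRing.Zmodule_isLmodule.Build loc_ring (loc_mod M)
  loc_scaleA loc_scale1 loc_scaleDr loc_scaleDl.

End LocLmodule.
End Localization.

Definition constant_rank (R : comNzRingType) (M : lmodType R) (d : nat) : Prop :=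
  forall P : prime_idealr R, free_of_rank (loc_mod P M) d.

Section AlgebrasWithTrace.
Variables (k : fieldType) (A : algType k) (C : centralSubalg A).

Definition is_trace (tr : A -> csub C) : Prop :=
  linear (tr : over_csub C -> (csub C)^o) /\
  (forall a b : A, tr (a * b) = tr (b * a)).

(* Rows and columns are numbered from 0 here. *)
Definition newton_mx (tr : A -> csub C) (a : A) (m : nat) : 'M[csub C]_m :=
  \matrix_(i, j)
    if (j <= i)%N then tr (a ^+ (i - j).+1)
    else if j == i.+1 :> nat then (i.+1)%:R else 0.

Definition char_coef (tr : A -> csub C) (a : A) (m : nat) : csub C :=
  ((m`!)%:R^-1 : k) *: \det (newton_mx tr a m).

Definition char_poly_tr (tr : A -> csub C) (n : nat) (a : A) : {poly csub C} :=
  'X^n + \sum_(1 <= m < n.+1) (-1) ^+ m * (char_coef tr a m)%:P * 'X^(n - m).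

Definition cayley_hamilton (tr : A -> csub C) (n : nat) : Prop :=
  [/\ is_trace tr,
      forall a : A, (map_poly (val : csub C -> A) (char_poly_tr tr n a)).[a] = 0
    & tr 1 = n%:R].

Definition hattori_stallings (B : dual_basis (over_csub C)) (a : A) : csub C :=
  \sum_(i < db_size B) db_coord i (a * (db_vec i : A) : A).

End AlgebrasWithTrace.

Definition cayley_hamilton_hopf (k : fieldType) (H : hopfAlgType k)
    (C : centralSubalg H) (tr : H -> csub C) (n : nat) : Prop :=
  hopf_subalgebra C /\ cayley_hamilton tr n.

(* Main.v *)
From HB Require Import structures.
Require Import Defs.
From mathcomp Require Import all_boot all_algebra.
From mathcomp Require Import generic_quotient ring_quotient.
From mathcomp Require Import perm boolp classical_sets ring zify.
Set Implicit Arguments.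
Unset Strict Implicit.
Unset Printing Implicit Defensive.
Import GRing.Theory.
Local Open Scope ring_scope.

(** Freeness comes from a Galois isomorphism.  Write C+ for the augmentation
    ideal of C and d for the dimension over k of H / H C+.  The map
    a (x) b |-> a b_1 (x) b_2 identifies H (x)_C H with H (x)_k H / H C+, that
    is, with H^d as a C-module.  Two consequences are used.

    - Over a domain Q receiving C, say with n the rank of H there, comparing the
      ranks of H (x)_C H and H^d gives n * n = n * d, hence n <= d: this is
      [local_rank_le].  So near every prime P of C, H is generated by d
      elements x_1, ..., x_d.
    - Tensoring with H the resulting surjection C_s^d -> H_s gives a surjection
      H_s^d -> H_s (x) H_s, the target being H_s^d again.  A surjective
      endomorphism of a finitely generated module over a commutative ring is
      injective, so a relation sum c_i x_i = 0 satisfies (c_i 1)_i = 0 in H_s^d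
      and is trivial because C embeds in H: this is [relations_torsion].

    Hence H is free of rank d near every prime of C, with a d that is read off
    at the counit and so is the same everywhere.  The elements t of C for which
    multiplication by t on H factors through a finite free module form an ideal
    contained in no prime; it contains 1, which gives a dual basis of H over C,
    so projectivity.

    The inverse of the Galois map uses the antipode:
    a (x) b |-> a S(b_1) (x) b_2.  Below, H (x)_C H enters only through the
    C-balanced bilinear maps on H.  The coordinates of the Galois map are the
    C-linear functions gamma_j (b) = b_1 pi_j (b_2), for pi_j the coordinates on
    H / H C+; its surjectivity is [galois_coord_surj], and
    [balanced_coordinates] evaluates an arbitrary C-balanced form on H through
    the gamma_j, which is its injectivity.

    For the trace, localize at a prime P: left multiplication by a becomes a
    matrix [local_rep a] over C_P, in a multiplicative and C-linear way, and
    its trace is the image of the Hattori-Stallings trace of a.  By Newton's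
    identities the determinants that define char_coef are, up to the invertible
    factor m!, the coefficients of the characteristic polynomial of that
    matrix, so that the Cayley-Hamilton theorem for matrices applies.  An
    element of H or of C that vanishes in the localization at every prime is 0,
    which transfers all three Cayley-Hamilton axioms from matrices to H. *)

(** * Linear maps given as predicates *)

(** bilinear_map speaks of the partial applications through the predicate
    linear; the theory of linear maps is transferred to it. *)
Section LinearPredicate.
Variables (R : nzRingType) (U V : lmodType R) (f : U -> V).
Hypothesis f_lin : linear f.

Let fl : {linear U -> V} :=
  HB.pack f (GRing.isLinear.Build R U V *:%R f f_lin).

Lemma linear_fun0 : f 0 = 0.
Proof. exact: (linear0 fl). Qed.

Lemma linear_funD : {morph f : u v / u + v}.
Proof. exact: (linearD fl). Qed.

Lemma linear_funZ a : {morph f : u / a *: u}.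
Proof. exact: (linearZZ fl). Qed.

Lemma linear_fun_sum I (r : seq I) (F : I -> U) :
  f (\sum_(i <- r) F i) = \sum_(i <- r) f (F i).
Proof. exact: (linear_sum fl). Qed.

End LinearPredicate.

(** * Prime ideals and local-global arguments *)

Definition is_ideal (R : comNzRingType) (J : R -> Prop) : Prop :=
  [/\ J 0, forall x y, J x -> J y -> J (x + y)
    & forall a x, J x -> J (a * x)].

(** An ideal maximal among the proper ideals that contain J is prime. *)
Lemma prime_above_proper_ideal (R : comNzRingType) (J : R -> Prop) :
  is_ideal J -> ~ J 1 ->
  exists P : prime_idealr R, forall x, J x -> x \in (P : {pred R}).
Proof.
move=> J_ideal J1.
(* The empty set is admitted so that the union of the empty chain is too. *)
pose ok (A : set R) := A = set0 \/ [/\ is_ideal A, ~ A 1 & J `<=` A]%classic.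
have [F okF totF|A [okA maxA]] := @Zorn_bigcup R ok.
  have [F0|/existsNP[A0 /not_implyP[FA0 A0n]]] :=
    pselect (forall A, F A -> A = set0).
    left; apply/seteqP; split=> x //= -[A FA Ax].
    by rewrite (F0 A FA) in Ax.
  have okid A : F A -> A !=set0%classic -> [/\ is_ideal A, ~ A 1 & J `<=` A]%classic.
    by move=> FA [x Ax]; case: (okF A FA) => // Aset0; rewrite Aset0 in Ax.
  have [[A00 _ _] A01 JA0] : [/\ is_ideal A0, ~ A0 1 & J `<=` A0]%classic.
    by case: (okF A0 FA0).
  right; split.
  - split=> [|x y [A FA Ax] [B FB By]|a x [A FA Ax]].
    + by exists A0.
    + have [AB|BA] := totF A B FA FB.
      * exists B => //; have [|[_ BD _] _ _] := okid B FB; first by exists y.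
        by apply: BD => //; apply: AB.
      * exists A => //; have [|[_ AD _] _ _] := okid A FA; first by exists x.
        by apply: AD => //; apply: BA.
    + exists A => //; have [|[_ _ AM] _ _] := okid A FA; first by exists x.
      exact: AM.
  - by move=> [A FA A1]; have [|_ + _] := okid A FA; [exists 1 | apply].
  - by move=> x Jx; exists A0 => //; apply: JA0.
have okJ : ok J by right; split.
have J0 : J 0 by case: J_ideal.
have [[A00 AD AM] A1 JA] : [/\ is_ideal A, ~ A 1 & J `<=` A]%classic.
  case: okA => // A0; case: (maxA J) => //; rewrite A0.
  by split=> // /(_ 0 J0).
have A_prime u v : A (u * v) -> A u \/ A v.
  move=> Auv; have [Au|nAu] := pselect (A u); first by left.
  right; pose B : set R := fun x => exists2 a, A a & exists c, x = a + c * u.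
  have sAB : (A `<=` B)%classic.
    by move=> x Ax; exists x => //; exists 0; rewrite mul0r addr0.
  have Bu : B u by exists 0 => //; exists 1; rewrite mul1r add0r.
  have [a Aa [c e]] : B 1.
    apply: contrapT => nB1; case: (maxA B); first by split=> // /(_ u Bu).
    right; split => //; last exact: subset_trans sAB.
    split; first exact: sAB.
      move=> x y [a Aa [c ->]] [b Ab [e ->]]; exists (a + b); first exact: AD.
      by exists (c + e); rewrite mulrDl addrACA.
    move=> b x [a Aa [c ->]]; exists (b * a); first exact: AM.
    by exists (b * c); rewrite mulrDr mulrA.
  have -> : v = v * a + c * (u * v) by rewrite -[LHS]mul1r e; ring.
  by apply: AD; apply: AM.
pose P : {pred R} := fun x => `[< A x >].
have PP x : reflect (A x) (x \in P) by exact: asboolP.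
have P_ideal : idealr_closed P.
  split; first exact/PP.
    by apply/negP => /PP.
  by move=> a u v /PP Au /PP Av; apply/PP/AD => //; apply: AM.
have P_prime : prime_idealr_closed P.
  by move=> u v /PP/A_prime[] /PP ->; rewrite ?orbT.
pose iP := isIdealr.Build R P P_ideal.
pose pP := isPrimeIdealrClosed.Build R P P_prime.
pose Q : prime_idealr R := HB.pack P iP pP.
by exists Q => x Jx; apply/PP/JA.
Qed.

(** To obtain 1 in an ideal it is enough to leave each prime in turn; both the
    global dual basis and the vanishing of elements are reduced to this. *)
Lemma ideal_local_global (R : comNzRingType) (J : R -> Prop) :
  is_ideal J ->
  (forall P : prime_idealr R, exists2 x, J x & x \notin (P : {pred R})) -> J 1.
Proof.
move=> J_ideal J_loc; apply: contrapT => /(prime_above_proper_ideal J_ideal).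
by move=> [P JP]; have [x /JP Px /negP] := J_loc P.
Qed.

(** * Coordinates at a point of the base ring *)

(** The e_i generate the localization of M at s. *)
Definition generates_away (R : comNzRingType) (M : lmodType R) (s : R)
    n (e : 'I_n -> M) : Prop :=
  forall m, exists c : 'I_n -> R, s *: m = \sum_i c i *: e i.

(** The e_i become a basis after base change along chi, once chi s is inverted.
    Clearing the denominator s keeps Q a mere domain: lam i is chi s times the
    i-th coordinate, so lam i (e j) is chi s or 0. *)
Definition coordinates_at (R Q : comNzRingType) (chi : R -> Q)
    (M : lmodType R) (s : R) n (e : 'I_n -> M) (lam : 'I_n -> M -> Q) : Prop :=
  [/\ chi s <> 0, generates_away s e
    & forall m c i, s *: m = \sum_j c j *: e j -> lam i m = chi (c i)].

(** A shortest family that generates away from some s outside the kernel of chi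
    is independent modulo that kernel: a relation with chi (c i) != 0 would
    express c i e_i through the other generators, and a shorter family would
    generate away from c i * s. *)
Lemma coordinates_exist (R Q : comNzRingType) (chi : {rmorphism R -> Q})
    (M : lmodType R) :
  (forall a b : Q, a * b = 0 -> a = 0 \/ b = 0) -> finitely_generated M ->
  exists s n (e : 'I_n -> M) (lam : 'I_n -> M -> Q), coordinates_at chi s e lam.
Proof.
move=> Q_dom M_fg.
pose ok n := `[< exists (s : R) (e : 'I_n -> M),
                   chi s <> 0 /\ generates_away s e >].
have ok_ex : exists n, ok n.
  have [n [e gen]] := M_fg; exists n; apply/asboolP; exists 1, e.
  split; first by rewrite rmorph1; apply/eqP/oner_neq0.
  by move=> m; have [c ->] := gen m; exists c; rewrite scale1r.
case: (ex_minnP ok_ex) => n /asboolP[s [e [s0 gen]]] n_min.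
have indep (c : 'I_n -> R) i : \sum_j c j *: e j = 0 -> chi (c i) = 0.
  case: n => [|n] in e gen n_min c i *; first by case: i.
  move=> rel; apply: contrapT => ci0.
  suff /n_min : ok n by rewrite ltnn.
  apply/asboolP; exists (c i * s), (fun j => e (lift i j)); split.
    by rewrite rmorphM /= => /Q_dom[].
  move=> m; have [a am] := gen m.
  exists (fun j => c i * a (lift i j) - a i * c (lift i j)).
  transitivity (c i *: (\sum_j a j *: e j) - a i *: (\sum_j c j *: e j)).
    by rewrite rel scaler0 subr0 -am scalerA.
  rewrite !scaler_sumr -sumrB (bigD1_ord i) //= !scalerA mulrC subrr add0r.
  by apply: eq_bigr => j _; rewrite !scalerA scalerBl.
pose c m := projT1 (cid (gen m)).
have cE m : s *: m = \sum_i c m i *: e i by rewrite /c; case: cid.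
exists s, n, e, (fun i m => chi (c m i)); split=> // m a i.
rewrite cE => /eqP; rewrite -subr_eq0 -sumrB => /eqP rel.
apply/eqP; rewrite -subr_eq0 -rmorphB; apply/eqP.
apply: (indep (fun j => c m j - a j) i).
by rewrite -[RHS]rel; apply: eq_bigr => j _; rewrite scalerBl.
Qed.

Section CoordinatesTheory.
Variables (R Q : comNzRingType) (chi : {rmorphism R -> Q}) (M : lmodType R).
Variables (s : R) (n : nat) (e : 'I_n -> M) (lam : 'I_n -> M -> Q).
Hypothesis co : coordinates_at chi s e lam.

Lemma coordinates_linear i : linear_for (chi \; *%R) (lam i).
Proof.
have [_ gen lamE] := co => a u v.
have [c cu] := gen u; have [c' cv] := gen v.
rewrite (lamE u c) // (lamE v c') // (lamE _ (fun j => a * c j + c' j)).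
  by rewrite rmorphD rmorphM.
rewrite scalerDr scalerA mulrC -scalerA cu cv scaler_sumr -big_split /=.
by apply: eq_bigr => j _; rewrite scalerDl scalerA.
Qed.

Lemma coordinates_gen i j : lam i (e j) = chi s *+ (i == j).
Proof.
have [_ _ lamE] := co; rewrite (lamE _ (fun l => s *+ (l == j))).
  by rewrite rmorphMn.
rewrite (bigD1 j) //= eqxx big1 ?addr0 // => l /negPf ->.
by rewrite scale0r.
Qed.

(** A chi-semilinear map is determined by its values on the e_i. *)
Lemma coordinates_expand (W : lmodType Q) (g : M -> W) :
  linear_for (chi \; *:%R) g ->
  forall m, chi s *: g m = \sum_i lam i m *: g (e i).
Proof.
have [_ gen lamE] := co => g_lin m.
have g0 : g 0 = 0.
  by have := g_lin (-1) 0 0; rewrite scaler0 addr0 /= rmorphN1 scaleN1r addNr.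
have gD : {morph g : u v / u + v}.
  by move=> u v; have := g_lin 1 u v; rewrite /= rmorph1 !scale1r.
have gZ c u : g (c *: u) = chi c *: g u.
  by have := g_lin c u 0; rewrite g0 !addr0.
have [c cm] := gen m; rewrite -gZ cm (big_morph g gD g0).
by apply: eq_bigr => i _; rewrite (lamE m c) // gZ.
Qed.

End CoordinatesTheory.

(** * Determinants, and surjective endomorphisms *)

(** A factorization through a smaller free module becomes square after padding
    with zeros, and then has a factor with a zero column. *)
Lemma det_mulmx_small (R : comNzRingType) m n (A : 'M[R]_(n, m))
    (B : 'M[R]_(m, n)) : (m < n)%N -> \det (A *m B) = 0.
Proof.
move=> lt_mn; have [p def_n] : exists p, n = (m + p.+1)%N.
  by exists (n - m).-1; rewrite prednK ?subn_gt0 // subnKC // ltnW.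
subst n.
have -> : A *m B = row_mx A (0 : 'M_(_, p.+1)) *m col_mx B 0.
  by rewrite mul_row_col mulmx0 addr0.
rewrite det_mulmx (expand_det_col _ (rshift m ord0)) big1 ?mul0r // => i _.
by rewrite row_mxEr mxE mul0r.
Qed.

(** Multiply the system by the adjugate of D. *)
Lemma det_annihilates (R : comNzRingType) (M : lmodType R) n (z : 'I_n -> M)
    (D : 'M[R]_n) :
  (forall i, \sum_j D i j *: z j = 0) -> forall i, \det D *: z i = 0.
Proof.
move=> Dz i.
have -> : \det D *: z i = \sum_j (\adj D *m D) i j *: z j.
  rewrite mul_adj_mx (bigD1 i) //= mxE eqxx big1 ?addr0 // => j ne_ji.
  by rewrite mxE eq_sym (negPf ne_ji) scale0r.
under eq_bigr => j _ do rewrite mxE scaler_suml.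
rewrite exchange_big big1 //= => l _.
under eq_bigr => j _ do rewrite -scalerA.
by rewrite -scaler_sumr Dz scaler0.
Qed.

(** M as a module over the polynomial ring, with 'X acting as f; the type
    synonym carries f so that the instance can depend on it. *)
Definition poly_module (R : comNzRingType) (M : lmodType R)
  (f : {linear M -> M}) : Type := M.

Section PolyModule.
Variables (R : comNzRingType) (M : lmodType R) (f : {linear M -> M}).

HB.instance Definition _ := GRing.Zmodule.on (poly_module f).

Definition poly_act (p : {poly R}) (m : poly_module f) : poly_module f :=
  \sum_(i < size p) p`_i *: (iter i f m : M).

Let iterf_linear n : linear (iter n f).
Proof. by elim: n => // n IHn a u v /=; rewrite IHn linearP. Qed.

Lemma poly_actE n (p : {poly R}) m : (size p <= n)%N ->
  poly_act p m = \sum_(i < n) p`_i *: (iter i f m : M).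
Proof.
move=> le_pn; rewrite /poly_act (big_ord_widen n (fun i => p`_i *: iter i f m)) //.
rewrite big_mkcond; apply: eq_bigr => i _; case: ltnP => // /leq_sizeP/(_ i).
by move=> ->; rewrite ?scale0r.
Qed.

Fact poly_actDl m : {morph poly_act^~ m : p q / p + q}.
Proof.
move=> p q; rewrite !(poly_actE (n := maxn (size p) (size q)))
  ?leq_maxl ?leq_maxr ?size_polyD //.
by rewrite -big_split; apply: eq_bigr => i _; rewrite coefD scalerDl.
Qed.

Fact poly_actDr : right_distributive poly_act +%R.
Proof.
move=> p u v; rewrite /poly_act -big_split; apply: eq_bigr => i _.
have -> : iter i f (u + v) = iter i f u + iter i f v.
  by have := iterf_linear i 1 u v; rewrite !scale1r.
by rewrite scalerDr.
Qed.

Lemma poly_actC c m : poly_act c%:P m = c *: (m : M).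
Proof.
by rewrite (poly_actE (n := 1)) ?size_polyC ?leq_b1 // big_ord1 coefC.
Qed.

Lemma poly_actMX p m : poly_act (p * 'X) m = poly_act p (f m).
Proof.
rewrite (poly_actE (n := (size p).+1)).
  rewrite big_ord_recl coefMX scale0r add0r; apply: eq_bigr => i _.
  by rewrite coefMX /= -iterSr.
have [->|p0] := eqVneq p 0; first by rewrite mul0r size_poly0.
by rewrite size_mulX.
Qed.

Lemma poly_actZ c p m : poly_act (c *: p) m = c *: (poly_act p m : M).
Proof.
rewrite (poly_actE (n := size p)) ?size_scale_leq // scaler_sumr.
by apply: eq_bigr => i _; rewrite coefZ scalerA.
Qed.

Fact poly_act1 : left_id 1 poly_act.
Proof. by move=> m; rewrite -[1]/(1%:P) poly_actC scale1r. Qed.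

Lemma poly_act_f p m : poly_act p (f m) = f (poly_act p m).
Proof.
rewrite /poly_act linear_sum; apply: eq_bigr => i _.
by rewrite linearZ -iterSr.
Qed.

Fact poly_actA p q m : poly_act p (poly_act q m) = poly_act (p * q) m.
Proof.
elim/poly_ind: p => [|p c IHp] in m *.
  by rewrite mul0r /poly_act size_poly0 !big_ord0.
rewrite mulrDl !poly_actDl !poly_actMX -mulrA ['X * q]mulrC mulrA.
rewrite poly_actMX -IHp (poly_act_f q); congr (_ + _).
by rewrite mul_polyC poly_actZ poly_actC.
Qed.

HB.instance Definition _ := GRing.Zmodule_isLmodule.Build {poly R}
  (poly_module f) poly_actA poly_act1 poly_actDr poly_actDl.

End PolyModule.

(** The localized form, with a uniform exponent, of the fact that a surjective
    endomorphism of a finitely generated module is injective.  If s z_i is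
    f (sum_j a_ij z_j) then s - 'X a annihilates the column of the generators
    z_i of M as an R['X]-module; so does its determinant, which is
    s ^ n modulo 'X, and 'X kills the kernel of f. *)
Lemma near_surjective_near_injective (R : comNzRingType) (M : lmodType R) (s : R)
    (f : {linear M -> M}) :
  finitely_generated M -> (forall m, exists m', s *: m = f m') ->
  exists N, forall m, f m = 0 -> s ^+ N *: m = 0.
Proof.
move=> [n [z gen]] f_surj; exists n => m fm0.
have [a aE] : exists a : 'I_n -> 'I_n -> R,
    forall i, s *: z i = f (\sum_j a i j *: z j).
  suff /choice[a aE] : forall i, exists c : 'I_n -> R,
      s *: z i = f (\sum_j c j *: z j) by exists a.
  by move=> i; have [m' ->] := f_surj (z i); have [c ->] := gen m'; exists c.
pose A : 'M[R]_n := \matrix_(i, j) a i j.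
pose D : 'M[{poly R}]_n := (s%:P)%:M - 'X *: map_mx polyC A.
pose V : lmodType {poly R} := poly_module f.
have XE (v : V) : 'X *: v = f v :> M.
  by have := poly_actMX (f := f) 1 v; rewrite mul1r poly_act1.
have CE c (v : V) : c%:P *: v = c *: (v : M) :> M by exact: poly_actC.
have Dz i : \sum_j D i j *: (z j : V) = 0.
  under eq_bigr => j _ do rewrite !mxE scalerBl.
  rewrite sumrB (bigD1 i) //= eqxx big1 ?addr0; last first.
    by move=> j ne_ji; rewrite eq_sym (negPf ne_ji) scale0r.
  apply/eqP; rewrite subr_eq0; apply/eqP.
  rewrite [LHS]CE aE -[LHS]XE.
  under [RHS]eq_bigr => j _ do rewrite -scalerA CE.
  by rewrite -scaler_sumr.
have detDm : \det D *: (m : V) = 0.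
  have [c ->] := gen m.
  transitivity (\det D *: (\sum_i (c i)%:P *: (z i : V))).
    by congr (_ *: _); apply: eq_bigr => i _; rewrite CE.
  rewrite scaler_sumr big1 // => i _.
  by rewrite scalerA mulrC -scalerA (det_annihilates Dz) scaler0.
have [q detDE] : exists q, \det D = (s ^+ n)%:P + q * 'X.
  have /factor_theorem[q qE] : root (\det D - (s ^+ n)%:P) 0.
    rewrite /root hornerD hornerN hornerC -horner_evalE -det_map_mx.
    have -> : map_mx (horner_eval 0) D = s%:M.
      apply/matrixP => i j; rewrite !mxE /horner_eval !hornerE.
      by rewrite hornerMn hornerC subr0.
    by rewrite det_scalar subrr.
  by exists q; rewrite -(subrK (s ^+ n)%:P (\det D)) qE subr0 addrC.
move: detDm; rewrite detDE scalerDl -scalerA.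
have -> : 'X *: (m : V) = 0 by rewrite [LHS]XE fm0.
by rewrite scaler0 addr0 CE.
Qed.

(** * Local bases *)

(** The images of the x_i in the localization at t form a basis; t phi_i is
    used in place of the i-th coordinate, and relations are killed by t itself
    rather than by a power of it. *)
Definition local_basis (R : comNzRingType) (M : lmodType R) (t : R)
    d (x : 'I_d -> M) (phi : 'I_d -> {linear M -> R^o}) : Prop :=
  (forall m, t *: m = \sum_i phi i m *: x i) /\
  (forall c : 'I_d -> R, \sum_i c i *: x i = 0 -> forall i, t * c i = 0).

(** The coefficients of s m on the x_i are determined up to an element killed by
    s ^ N, so s ^ N times them is a function of m, and is linear. *)
Lemma local_basis_of_generators (R : comNzRingType) (M : lmodType R) (s : R)
    N d (x : 'I_d -> M) :
  generates_away s x ->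
  (forall c : 'I_d -> R, \sum_i c i *: x i = 0 -> forall i, s ^+ N * c i = 0) ->
  exists phi, local_basis (s ^+ N.+1) x phi.
Proof.
move=> gen indep.
pose c m := projT1 (cid (gen m)).
have cE m : s *: m = \sum_i c m i *: x i by rewrite /c; case: cid.
pose phi i m : R^o := s ^+ N * c m i.
have phi_lin i : linear (phi i).
  move=> a u v; apply/eqP; rewrite -subr_eq0; apply/eqP.
  transitivity (s ^+ N * (c (a *: u + v) i - (a * c u i + c v i))).
    have -> : a *: phi i u = a * (s ^+ N * c u i) :> R by [].
    by rewrite /phi; ring.
  apply: (indep (fun j => c (a *: u + v) j - (a * c u j + c v j))).
  under eq_bigr => j _ do rewrite scalerBl scalerDl -scalerA.
  rewrite sumrB big_split /= -scaler_sumr -!cE scalerDr !scalerA.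
  by rewrite [s * a]mulrC subrr.
pose iphi i := GRing.isLinear.Build R M R^o *:%R (phi i) (phi_lin i).
pose phil i : {linear M -> R^o} := HB.pack (phi i) (iphi i).
exists phil; split=> [m|a rel i].
  rewrite exprSr -scalerA cE scaler_sumr.
  by apply: eq_bigr => i _; rewrite scalerA.
by rewrite exprS -mulrA indep ?mulr0.
Qed.

Lemma dual_basis_projective (R : comNzRingType) (M : lmodType R) :
  dual_basis M -> projective M.
Proof.
move=> [n x phi expand] N P g f g_surj.
have /choice[y yE] : forall i, exists y, g y = f (x i) by move=> i; apply: g_surj.
pose h m : N := \sum_i phi i m *: y i.
have h_lin : linear h.
  move=> a u v; rewrite /h scaler_sumr -big_split; apply: eq_bigr => i _.
  by rewrite linearP scalerDl -scalerA.
pose ih := GRing.isLinear.Build R M N *:%R h h_lin.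
pose hl : {linear M -> N} := HB.pack h ih.
exists hl => m; rewrite [in RHS](expand m) !linear_sum.
by apply: eq_bigr => i _; rewrite !linearZ yE.
Qed.

(** The t such that t m = sum phi_i(m) x_i for some finite system of vectors and
    linear forms are an ideal: systems are concatenated to add, and the vectors
    are multiplied to scale. *)
Lemma dual_basis_local_global (R : comNzRingType) (M : lmodType R) :
  (forall P : prime_idealr R, exists d t (x : 'I_d -> M) phi,
     t \notin (P : {pred R}) /\ local_basis t x phi) ->
  inhabited (dual_basis M).
Proof.
move=> loc.
pose J t := exists n (x : 'I_n -> M) (phi : 'I_n -> {linear M -> R^o}),
  forall m, t *: m = \sum_i phi i m *: x i.
suff : J 1.
  move=> [n [x [phi expand]]]; constructor; exists n x phi => m.
  by rewrite -expand scale1r.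
apply: ideal_local_global => [|P]; last first.
  by have [d [t [x [phi [Pt [xE _]]]]]] := loc P; exists t => //; exists d, x, phi.
split=> [|t u [n [x [phi xE]]] [m [y [psi yE]]]|a t [n [x [phi xE]]]].
- exists 0%N, (fun=> 0), (fun=> \0) => m.
  by rewrite big_ord0 scale0r.
- exists (n + m)%N, (fun i => match split i with inl j => x j | inr j => y j end).
  exists (fun i => match split i with inl j => phi j | inr j => psi j end) => v.
  rewrite scalerDl xE yE big_split_ord; congr (_ + _); apply: eq_bigr => i _.
    by rewrite (unsplitK (inl i)).
  by rewrite (unsplitK (inr i)).
- exists n, (fun i => a *: x i), phi => m.
  rewrite -scalerA xE scaler_sumr; apply: eq_bigr => i _.
  by rewrite !scalerA mulrC.
Qed.

Section LocalFreeness.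
Local Notation frac := Defs.frac.
Variables (R : comNzRingType) (P : prime_idealr R).

Lemma frac_sum (M : lmodType R) n (m : 'I_n -> M) (w : denom P) :
  \sum_i frac (m i) w = frac (\sum_i m i) w.
Proof.
have frac0 : frac (0 : M) w = 0 by apply: frac_eq; rewrite !scaler0.
have fracD : {morph (frac (M := M))^~ w : u v / u + v}.
  move=> u v; rewrite frac_add; apply: frac_eq => /=.
  by rewrite -scalerDr scalerA.
by rewrite (big_morph _ fracD frac0).
Qed.

Lemma common_denominator n (c : 'I_n -> loc_ring P) :
  exists (w : denom P) (a : 'I_n -> R), forall i, c i = rfrac (a i) w.
Proof.
elim: n c => [|n IHn] c; first by exists (denom1 P), (fun=> 0) => -[].
have [w [a aE]] := IHn (fun i => c (lift ord0 i)).
have [b [s cE]] : exists b s, c ord0 = rfrac b s.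
  by exists (repr (c ord0)).1, (repr (c ord0)).2; rewrite rfracE.
exists (denomM s w).
exists (fun i => if unlift ord0 i is Some j then val s * a j else val w * b) => i.
case: unliftP => [j ->|->]; rewrite ?aE ?cE; apply: rfrac_eq => /=; ring.
Qed.

Lemma sum_rfrac_scale (M : lmodType R) n (z : 'I_n -> M) (a : 'I_n -> R) w :
  \sum_i rfrac (a i) w *: frac (z i) (denom1 P) = frac (\sum_i a i *: z i) w.
Proof.
rewrite -frac_sum; apply: eq_bigr => i _.
by rewrite [LHS]loc_scaleE; apply: frac_eq => /=; rewrite mulr1.
Qed.

(** Coordinates in the localization are phi_i / t.  For unicity, a common
    denominator turns a relation over the local ring into one over R, up to a
    further element outside P. *)
Lemma localization_free (M : lmodType R) t d (x : 'I_d -> M) phi :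
  t \notin (P : {pred R}) -> local_basis t x phi ->
  free_of_rank (loc_mod P M) d.
Proof.
move=> Pt [expand indep]; pose T : denom P := exist _ t Pt.
exists (fun i => frac (x i) (denom1 P)) => q.
pose ci (i : 'I_d) : (loc_ring P : comNzRingType) :=
  rfrac (phi i (repr q).1 : R) (denomM T (repr q).2).
pose c := [ffun i : 'I_d => ci i].
exists c; split.
  under eq_bigr => i _ do rewrite ffunE.
  rewrite sum_rfrac_scale -expand -[LHS]fracE; apply: frac_eq => /=.
  by rewrite scalerA mulrC.
move=> c' qE.
have [w [a aE]] := common_denominator (fun i => c i - c' i).
apply/ffunP => i; apply/eqP; rewrite -subr_eq0 aE; apply/eqP.
have : frac (\sum_i a i *: x i) w = 0.
  rewrite -sum_rfrac_scale; under eq_bigr => j _ do rewrite -aE scalerBl.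
  rewrite sumrB -qE; apply/eqP; rewrite subr_eq0; apply/eqP.
  under eq_bigr => j _ do rewrite ffunE.
  rewrite sum_rfrac_scale -expand -[RHS]fracE; apply: frac_eq => /=.
  by rewrite scalerA mulrC.
move=> /fracP[u /=]; rewrite scale1r !scaler0 scaler_sumr => rel.
have {}rel : \sum_i (val u * a i) *: x i = 0.
  by rewrite -[RHS]rel; apply: eq_bigr => j _; rewrite scalerA.
apply/fracP; exists (denomM T u) => /=; rewrite !scaler0 scale1r.
rewrite -[LHS]/(t * val u * a i) -mulrA.
exact: (indep (fun j => val u * a j)).
Qed.

Definition to_loc (a : R) : loc_ring P := rfrac a (denom1 P).

Fact to_loc_zmod_morphism : zmod_morphism to_loc.
Proof.
move=> a b; have -> : - to_loc b = rfrac (- b) (denom1 P) by exact: loc_oppE.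
rewrite /to_loc rfrac_add; apply: rfrac_eq => /=; ring.
Qed.

Fact to_loc_monoid_morphism : monoid_morphism to_loc.
Proof.
split=> // a b; rewrite /to_loc [RHS]loc_mulE; apply: rfrac_eq => /=; ring.
Qed.

HB.instance Definition _ := GRing.isZmodMorphism.Build R (loc_ring P) to_loc
  to_loc_zmod_morphism.
HB.instance Definition _ := GRing.isMonoidMorphism.Build R (loc_ring P) to_loc
  to_loc_monoid_morphism.

End LocalFreeness.

Lemma zero_locally (R : comNzRingType) (M : lmodType R) (m : M) :
  (forall P : prime_idealr R, Defs.frac m (denom1 P) = 0) -> m = 0.
Proof.
move=> loc; rewrite -[m]scale1r.
apply: (@ideal_local_global R (fun a => a *: m = 0)) => [|P].
  split=> [|a b am bm|a b bm]; first exact: scale0r.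
    by rewrite scalerDl am bm addr0.
  by rewrite -scalerA bm scaler0.
have /fracP[u /=] := loc P; rewrite scale1r !scaler0 => um.
by exists (val u); [exact: um | exact: (valP u)].
Qed.

(** * Newton's identities *)

Lemma deriv_prod_ord (R : comNzRingType) n (F : 'I_n -> {poly R}) :
  (\prod_i F i)^`() = \sum_i (F i)^`() * \prod_(j | i != j) F j.
Proof.
elim: n F => [|n IHn] F; first by rewrite !big_ord0 derivC.
rewrite !big_ord_recl derivM IHn mulr_sumr; congr (_ * _ + _).
  by rewrite [RHS]big_mkcond big_ord_recl /= mul1r.
apply: eq_bigr => i _; rewrite mulrCA; congr (_ * _).
rewrite [RHS]big_mkcond big_ord_recl /=; congr (_ * _).
by rewrite big_mkcond.
Qed.

(** Jacobi's formula: differentiating the Leibniz expansion of the determinant of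
    'X - A row by row leaves the diagonal cofactors, as the derivative of row i
    is the i-th unit vector. *)
Lemma deriv_char_poly (R : comNzRingType) n (A : 'M[R]_n) :
  (char_poly A)^`() = \tr (\adj (char_poly_mx A)).
Proof.
rewrite /char_poly /determinant raddf_sum /mxtrace.
transitivity (\sum_(s : 'S_n) \sum_(i | s i == i)
    (-1) ^+ s * \prod_(j | i != j) char_poly_mx A j (s j)); last first.
  rewrite (exchange_big_dep predT) //=; apply: eq_bigr => i _.
  by rewrite mxE expand_cofactor.
apply: eq_bigr => s _ /=; rewrite [RHS]big_mkcond.
have -> : (-1) ^+ s = ((-1) ^+ s)%:P :> {poly R} by rewrite rmorphXn rmorphN1.
rewrite mul_polyC derivZ -mul_polyC deriv_prod_ord mulr_sumr.
apply: eq_bigr => i _; rewrite !mxE derivB derivC subr0 derivMn derivX.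
by rewrite eq_sym; case: eqP; rewrite ?mul1r ?mul0r ?mulr0.
Qed.

(** Newton's identities, valid over any commutative ring.  If B_k is the
    coefficient of 'X^k in 'X adj('X - A), then adj('X - A) ('X - A) = f gives
    B_k = f_k + B_(k+1) A, so B_k = sum_j f_(k+j) A^j; and its trace is k f_k by
    Jacobi's formula. *)
Lemma newton_char_poly (R : comNzRingType) d (A : 'M[R]_d) m : (m <= d)%N ->
  m%:R * (char_poly A)`_(d - m) +
    \sum_(1 <= j < m.+1) (char_poly A)`_(d - m + j) * \tr (A ^+ j) = 0.
Proof.
move=> le_md; set f := char_poly A.
pose B k : 'M[R]_d := map_mx (coefp k) ('X *: \adj (char_poly_mx A)).
have B_rec k : B k = (f`_k)%:M + B k.+1 *m A.
  have := mul_adj_mx (char_poly_mx A).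
  rewrite -/(char_poly A) -/f {2}/char_poly_mx mulmxBr mul_mx_scalar.
  move=> /matrixP e; apply/matrixP => i j.
  have /(congr1 (coefp k)) /= := e i j.
  rewrite !mxE coefB coefMn /= => <-.
  rewrite coef_sum -[LHS]addr0 -addrA; congr (_ + _).
  rewrite addrC -sumrB big1 // => l _.
  by rewrite !mxE coefMC /= coefXM subrr.
have B_exp N k : B k = \sum_(j < N) f`_(k + j) *: A ^+ j + B (k + N)%N *m A ^+ N.
  elim: N => [|N IHN]; first by rewrite big_ord0 add0r addn0 expr0 mulmx1.
  rewrite big_ord_recr /= {1}IHN B_rec mulmxDl mul_scalar_mx addrA addnS.
  by rewrite -mulmxA exprS.
have [N0 B0] : exists N0, forall k, (N0 <= k)%N -> B k = 0.
  pose sz i j := size ('X * \adj (char_poly_mx A) i j).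
  exists (\max_i \max_j sz i j)%N => k le_k.
  apply/matrixP => i j; rewrite [LHS]mxE [RHS]mxE /=.
  have -> : ('X *: \adj (char_poly_mx A)) i j = 'X * \adj (char_poly_mx A) i j.
    by rewrite [LHS]mxE.
  apply/(leq_sizeP _ k) => //; apply: leq_trans le_k.
  apply: leq_trans (leq_bigmax (F := fun i => (\max_j sz i j)%N) i).
  exact: (leq_bigmax (F := sz i) j).
have trB k : \tr (B k) = f`_k *+ k.
  have := deriv_char_poly A; rewrite -/f => /(congr1 ( *%R 'X)).
  move=> /(congr1 (coefp k)) /=; rewrite coefXM coef_deriv => e.
  transitivity (('X * \tr (\adj (char_poly_mx A)))`_k).
    rewrite /mxtrace mulr_sumr coef_sum; apply: eq_bigr => i _.
    by rewrite !mxE.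
  by rewrite -e; case: k {e}.
set k := (d - m)%N; have := trB k.
rewrite (B_exp (m.+1 + N0)%N) B0 ?mul0mx ?addr0; last first.
  by rewrite addnA leq_addl.
rewrite raddf_sum /= big_split_ord /= [X in _ + X]big1 ?addr0; last first.
  move=> j _; rewrite nth_default ?scale0r ?raddf0 // size_char_poly.
  by rewrite /k; lia.
rewrite big_ord_recl addn0 expr0 mxtraceZ mxtrace1 => e.
rewrite big_add1 /= big_mkord.
under eq_bigr => j _ do rewrite -mxtraceZ.
apply/eqP; rewrite addrC addr_eq0; apply/eqP.
transitivity (f`_k *+ k - f`_k * d%:R).
  by rewrite -e [RHS]addrC addKr; apply: eq_bigr => j _.
have dE : d%:R = m%:R + k%:R :> R by rewrite -natrD /k subnKC.
transitivity (f`_k * k%:R - f`_k * (m%:R + k%:R)); last by ring.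
by rewrite -dE -[X in X - _]mulr_natr.
Qed.

(** The matrix newton_mx, with an arbitrary sequence for the power sums. *)
Definition newton_matrix (R : nzRingType) (p : nat -> R) m : 'M[R]_m :=
  \matrix_(i, j) if (j <= i)%N then p (i - j).+1
                 else if j == i.+1 :> nat then i.+1%:R else 0.

(** Newton's identities say that the matrix N sends the column (a_0, ..., a_(m-1))
    to a multiple of the last unit vector.  Cramer's rule for the first entry
    a_0 = 1 then gives the determinant, the cofactor involved being triangular
    with diagonal 1, ..., m - 1. *)
Lemma det_newton_matrix (R : comNzRingType) (p a : nat -> R) m :
  a 0%N = 1 ->
  (forall i, (i <= m)%N ->
     i%:R * a i + \sum_(1 <= j < i.+1) a (i - j)%N * p j = 0) ->
  \det (newton_matrix p m) = (-1) ^+ m * m`!%:R * a m.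
Proof.
move=> a0; case: m => [|m] newton.
  by rewrite det_mx00 a0 fact0 !mulr1.
set N := newton_matrix p m.+1.
pose v : 'cV[R]_m.+1 := \col_i a i.
have Nv : N *m v = (- (m.+1%:R * a m.+1)) *: delta_mx ord_max 0.
  apply/matrixP => i j; rewrite !mxE ord1 eqxx andbT.
  have le_i : (i <= m)%N by rewrite -ltnS.
  under eq_bigr => l _ do rewrite !mxE.
  (* Extended to all l, the row vanishes beyond l = i + 1; for the last row that
     entry falls outside the matrix. *)
  pose F l := (if (l <= i)%N then p (i - l).+1
               else if l == i.+1 then i.+1%:R else 0) * a l.
  transitivity (\sum_(l < i.+2) F l - (if i == ord_max then F i.+1 else 0)).
    rewrite [X in _ = X - _](big_ord_widen m.+2 F) ?ltnS //.
    rewrite [X in _ = X - _]big_mkcond [X in _ = X - _]big_ord_recr /=.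
    rewrite (_ : (m.+1 < i.+2)%N = (m <= i)%N) //.
    rewrite -addrA -[LHS]addr0; congr (_ + _).
      apply: eq_bigr => l _; rewrite ltnS -/(F l); case: leqP => // lt_il.
      rewrite /F leqNgt (ltn_trans _ lt_il) // eq_sym (ltn_eqF lt_il).
      by rewrite mul0r.
    have -> : (i == ord_max) = (m <= i)%N.
      by rewrite -val_eqE /= eqn_leq le_i.
    case: ifP => [le_mi|_]; last by rewrite subr0.
    have -> : nat_of_ord i = m by apply/eqP; rewrite eqn_leq le_i.
    by rewrite subrr.
  rewrite big_ord_recr /=.
  have -> : F i.+1 = i.+1%:R * a i.+1 by rewrite /F ltnn eqxx.
  have /eqP : i.+1%:R * a i.+1 + \sum_(l < i.+1) F l = 0.
    rewrite -[RHS](newton i.+1); last by rewrite ltnS.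
    congr (_ + _); rewrite big_add1 /= big_mkord [RHS](reindex_inj rev_ord_inj) /=.
    apply: eq_bigr => l _; have le_li : (l <= i)%N by rewrite -ltnS.
    by rewrite /F le_li !subSS subKn // mulrC.
  rewrite addrC => /eqP ->; rewrite sub0r.
  case: eqP => [->|_] /=; by rewrite ?mulr1 ?mulr0 ?oppr0.
have : \det N = (\adj N *m (N *m v)) 0 0.
  by rewrite mulmxA mul_adj_mx mul_scalar_mx !mxE a0 mulr1.
rewrite Nv -scalemxAr mxE -colE mxE mxE /cofactor => ->.
have -> : \det (row' ord_max (col' 0 N)) = m`!%:R.
  have bump_max (i : 'I_m.+1.-1) : (m <= i)%N = false.
    by rewrite leqNgt (ltn_ord i).
  rewrite det_trig; last first.
    apply/is_trig_mxP => i j lt_ij; rewrite !mxE /= /bump /= bump_max add0n.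
    by rewrite add1n ltnNge (ltnW lt_ij) /= eqSS eq_sym (ltn_eqF lt_ij).
  rewrite fact_prod natr_prod big_add1 /= big_mkord; apply: eq_bigr => i _.
  by rewrite !mxE /= /bump /= bump_max add0n add1n ltnn eqxx.
rewrite addn0 factS natrM exprS; ring.
Qed.

(** * Matrices of left multiplications *)

Section LeftMultiplication.
Variables (k : fieldType) (A : algType k) (C : centralSubalg A).

Definition lmul (a : A) (m : over_csub C) : over_csub C := (a * (m : A) : A).

Fact lmul_is_linear a : linear (lmul a).
Proof.
move=> c u v; rewrite /lmul [LHS](mulrDr (a : A)); congr (_ + _).
rewrite [LHS](mulrA (a : A)) -(central_subproof (s := C) (val c) a (valP c)).
by rewrite -mulrA.
Qed.

HB.instance Definition _ a := GRing.isLinear.Build (csub C) (over_csub C)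
  (over_csub C) *:%R (lmul a) (lmul_is_linear a).

Lemma lmulA a b m : lmul (a * b) m = lmul a (lmul b m).
Proof. by rewrite /lmul mulrA. Qed.

Lemma lmulDl a b m : lmul (a + b) m = lmul a m + lmul b m.
Proof. exact: (mulrDl (a : A)). Qed.

Lemma lmul_csub (c : csub C) m : lmul (val c) m = c *: m.
Proof. by []. Qed.

End LeftMultiplication.

Lemma rfrac_sum (R : comNzRingType) (P : prime_idealr R) n (c : 'I_n -> R)
    (w : denom P) :
  \sum_i rfrac (c i) w = rfrac (\sum_i c i) w.
Proof. exact: (@frac_sum R P R^o). Qed.

Lemma linear_formZ (R : comNzRingType) (M : lmodType R)
    (f : {linear M -> R^o}) (c : R) m : f (c *: m) = c * f m :> R.
Proof. exact: (linearZZ f). Qed.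

Section LocalRepresentation.
Variables (k : fieldType) (A : algType k) (C : centralSubalg A).
Variables (P : prime_idealr (csub C)) (t : csub C) (d : nat).
Variables (x : 'I_d -> over_csub C).
Variables (phi : 'I_d -> {linear over_csub C -> (csub C)^o}).
Hypotheses (Pt : t \notin (P : {pred csub C})) (tB : local_basis t x phi).

Local Notation R := (csub C).
Local Notation M := (over_csub C).
Local Notation L := (loc_ring P).
Local Notation iota := (to_loc P).
Local Notation frac := Defs.frac.
Let T : denom P := exist _ t Pt.

(** The matrix of the left multiplication by a, in the basis x of the
    localization at P, whose coordinates are phi_i / t. *)
Definition local_rep (a : A) : 'M[L]_d :=
  \matrix_(i, j) rfrac (phi i (lmul a (x j)) : R) T.

Lemma local_repD a b : local_rep (a + b) = local_rep a + local_rep b.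
Proof.
apply/matrixP => i j; rewrite !mxE lmulDl linearD rfrac_add.
by apply: rfrac_eq => /=; rewrite -mulrDr mulrA.
Qed.

Lemma local_repM a b : local_rep (a * b) = local_rep a *m local_rep b.
Proof.
apply/matrixP => i j; rewrite !mxE.
have [expand _] := tB.
transitivity (rfrac (\sum_l (phi i (lmul a (x l)) : R) * phi l (lmul b (x j)))
                (denomM T T)).
  apply: rfrac_eq => /=.
  rewrite -mulrA; congr (_ * _).
  transitivity (phi i (t *: lmul (a * b) (x j)) : R).
    by rewrite linear_formZ.
  rewrite lmulA -linearZZ expand !linear_sum; apply: eq_bigr => l _.
  by rewrite linearZZ linear_formZ mulrC.
rewrite -rfrac_sum; apply: eq_bigr => l _.
by rewrite !mxE [RHS]loc_mulE.
Qed.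

Lemma local_rep_csub (c : R) : local_rep (val c) = (iota c)%:M.
Proof.
have [expand indep] := tB.
apply/matrixP => i j; rewrite !mxE lmul_csub linear_formZ.
have tphi : t * (phi i (x j) : R) = t * (t *+ (i == j)).
  apply/eqP; rewrite -subr_eq0 -mulrBr; apply/eqP.
  apply: (indep (fun i => (phi i (x j) : R) - t *+ (i == j))).
  under eq_bigr => l _ do rewrite scalerBl.
  rewrite sumrB -expand (bigD1 j) //= eqxx big1 ?addr0 ?subrr // => l.
  by move=> /negPf ->; rewrite scale0r.
transitivity (rfrac (c * t *+ (i == j)) T).
  apply/fracP; exists T => /=.
  transitivity (t * c * (t * (phi i (x j) : R))).
    by rewrite -[LHS]/(t * (t * (c * _))); ring.
  by rewrite tphi -[RHS]/(t * (t * (c * t *+ (i == j)))) -!mulrnAr; ring.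
case: eqP => _; first by apply: rfrac_eq => /=; rewrite mul1r mulrC.
by apply: frac_eq; rewrite !scaler0.
Qed.

(** If w acts as 0 on the basis x then w = w 1 is 0 in the localization. *)
Lemma local_rep_eq0 w : local_rep w = 0 -> frac (w : M) (denom1 P) = 0.
Proof.
have [expand _] := tB => /matrixP w0.
have wx j : frac (lmul w (x j)) (denom1 P) = 0.
  transitivity (frac (t *: lmul w (x j)) T).
    by apply: frac_eq => /=; rewrite scale1r.
  rewrite expand -sum_rfrac_scale big1 // => i _.
  by have := w0 i j; rewrite !mxE => ->; rewrite scale0r.
transitivity (frac (lmul w (t *: ((1 : A) : M))) T).
  apply: frac_eq; rewrite linearZZ /= scale1r; congr (_ *: _).
  exact/esym/mulr1.
rewrite expand linear_sum /=.
under eq_bigr => j _ do rewrite linearZZ.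
by rewrite -sum_rfrac_scale big1 // => j _; rewrite wx scaler0.
Qed.

(** The Hattori-Stallings trace does not depend on the dual basis, here computed
    both from B and from the local basis: t tr(a) = sum_j b_j^*(a t b_j), where
    t b_j is expanded on x, and then a x_i on B. *)
Lemma tr_local_rep (B : dual_basis M) a :
  iota (hattori_stallings B a) = \tr (local_rep a).
Proof.
have [expand _] := tB.
rewrite /mxtrace; under eq_bigr => i _ do rewrite mxE.
rewrite rfrac_sum; apply: rfrac_eq => /=.
rewrite mul1r /hattori_stallings mulr_sumr.
transitivity (\sum_j \sum_i
    (phi i (db_vec (d := B) j) : R) * db_coord (d := B) j (lmul a (x i))).
  apply: eq_bigr => j _.
  rewrite -[LHS](linearZZ (db_coord (d := B) j)) -[a * _]/(lmul a _) -linearZZ expand.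
  rewrite !linear_sum; apply: eq_bigr => i _.
  by rewrite !linearZZ.
rewrite exchange_big; apply: eq_bigr => i _ /=.
rewrite {2}[lmul a (x i)](db_expand B) linear_sum; apply: eq_bigr => j _.
by rewrite linearZZ mulrC.
Qed.

End LocalRepresentation.

(** * The Cayley-Hamilton identity *)

Lemma sign_coef_monomial (R : comNzRingType) e (c : R) i :
  (-1) ^+ e * ((-1) ^+ e * c)%:P * 'X^i = c *: 'X^i.
Proof.
by rewrite polyCM (rmorph_sign polyC) mulrA -expr2 sqrr_sign mul1r mul_polyC.
Qed.

Lemma cayley_hamilton_sum (R : comNzRingType) d (A : 'M[R]_d) :
  \sum_(i < d.+1) (char_poly A)`_i *: A ^+ i = 0.
Proof.
case: d A => [|d] A; first exact: flatmx0.
rewrite -[RHS](Cayley_Hamilton A) /horner_mx /horner_morph.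
rewrite (horner_coef_wide (n := d.+2)); last first.
  by apply: leq_trans (size_poly _ _) _; rewrite size_char_poly.
by apply: eq_bigr => i _; rewrite coef_map /= -scalemx1 -scalerAl mul1r.
Qed.

Section LocalCayleyHamilton.
Variables (k : fieldType) (A : algType k) (C : centralSubalg A).
Variables (P : prime_idealr (csub C)) (t : csub C) (d : nat).
Variables (x : 'I_d -> over_csub C).
Variables (phi : 'I_d -> {linear over_csub C -> (csub C)^o}).
Hypotheses (Pt : t \notin (P : {pred csub C})) (tB : local_basis t x phi).
Hypothesis k_char0 : [pchar k] =i pred0.
Variable tr : A -> csub C.
Local Notation rho := (local_rep x phi Pt).
Local Notation iota := (to_loc P).
Hypothesis tr_rho : forall a, iota (tr a) = \tr (rho a).

Lemma local_rep1 : rho 1 = 1.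
Proof.
have -> : (1 : A) = val (1 : csub C) by [].
by rewrite (local_rep_csub Pt tB) rmorph1.
Qed.

Lemma local_repX a n : rho (a ^+ n) = rho a ^+ n.
Proof.
elim: n => [|n IHn]; first exact: local_rep1.
by rewrite !exprS (local_repM Pt tB) IHn.
Qed.

Lemma fact_char_coef a m :
  (m`!)%:R * char_coef tr a m = \det (newton_mx tr a m).
Proof.
rewrite /char_coef -scalerAr mulr_natl -scaler_nat scalerA mulVf ?scale1r //.
by move/pcharf0P: k_char0 => ->; rewrite -lt0n fact_gt0.
Qed.

(** Both sides agree after multiplication by m!, a unit as k has characteristic
    0, by the determinant formula for Newton's identities. *)
Lemma to_loc_char_coef a m : (m <= d)%N ->
  iota (char_coef tr a m) = (-1) ^+ m * (char_poly (rho a))`_(d - m).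
Proof.
move=> le_md.
have fact_unit : iota ((m`!)%:R^-1 : k)%:A * (m`!)%:R = 1.
  rewrite -(rmorph_nat iota) -rmorphM /= -scalerAl mul1r -scaler_nat scalerA.
  rewrite mulVf ?scale1r ?rmorph1 //.
  by move/pcharf0P: k_char0 => ->; rewrite -lt0n fact_gt0.
set y := RHS; rewrite -[LHS]mul1r -[RHS]mul1r -fact_unit -!mulrA; congr (_ * _).
rewrite -[in LHS](rmorph_nat iota) -rmorphM fact_char_coef -det_map_mx.
have -> : map_mx iota (newton_mx tr a m) =
          newton_matrix (fun j => \tr (rho a ^+ j)) m.
  apply/matrixP => i j; rewrite !mxE; case: ifP => _.
    by rewrite tr_rho local_repX.
  by case: ifP => _; rewrite ?rmorph_nat ?rmorph0.
rewrite (det_newton_matrix (a := fun i => (char_poly (rho a))`_(d - i))).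
- by rewrite /y [RHS]mulrCA mulrA.
- rewrite subn0; have /monicP := char_poly_monic (rho a).
  by rewrite /lead_coef size_char_poly.
move=> i le_im; have le_id := leq_trans le_im le_md.
rewrite -[RHS](newton_char_poly (rho a) le_id); congr (_ + _).
rewrite !big_nat; apply: eq_bigr => j /andP[j0 le_ji].
congr (_`_ _ * _); lia.
Qed.

Lemma to_loc_char_poly a :
  map_poly iota (char_poly_tr tr d a) = char_poly (rho a).
Proof.
rewrite /char_poly_tr rmorphD rmorph_sum /= map_polyXn.
have -> : char_poly (rho a) = \sum_(i < d.+1) (char_poly (rho a))`_i *: 'X^i.
  by rewrite -{1}[char_poly _]coefK size_char_poly poly_def.
rewrite big_ord_recr /= [RHS]addrC; congr (_ + _).
  have /monicP := char_poly_monic (rho a).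
  by rewrite /lead_coef size_char_poly /= => ->; rewrite scale1r.
rewrite big_add1 /= big_mkord (reindex_inj rev_ord_inj) /=.
apply: eq_bigr => i _; have lt_id := ltn_ord i.
rewrite !rmorphM /= rmorphXn rmorphN1 map_polyC map_polyXn /=.
rewrite to_loc_char_coef; last by lia.
have -> : (d - (d - i.+1).+1 = i)%N by lia.
exact: sign_coef_monomial.
Qed.

Lemma horner_map_rho (p : {poly csub C}) a :
  rho ((map_poly (val : csub C -> A) p).[a]) =
  \sum_(i < size p) iota p`_i *: rho a ^+ i.
Proof.
rewrite horner_coef size_map_inj_poly ?rmorph0 //; last exact: val_inj.
have rhoD : {morph rho : u v / u + v} by move=> u v; exact: local_repD.
have rho0 : rho 0 = 0.
  by have /eqP := rhoD 0 0; rewrite addr0 -subr_eq subrr => /eqP.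
rewrite (big_morph _ rhoD rho0); apply: eq_bigr => i _.
rewrite (local_repM Pt tB) local_repX coef_map_id0 //=.
by rewrite (local_rep_csub Pt tB) mul_scalar_mx.
Qed.

Lemma rho_cayley_hamilton a :
  rho ((map_poly (val : csub C -> A) (char_poly_tr tr d a)).[a]) = 0.
Proof.
rewrite horner_map_rho; set p := char_poly_tr tr d a.
transitivity (\sum_(i < size p) (char_poly (rho a))`_i *: rho a ^+ i).
  by apply: eq_bigr => i _; rewrite -to_loc_char_poly coef_map.
have le_dp : (d.+1 <= size p)%N.
  by rewrite -(size_char_poly (rho a)) -to_loc_char_poly size_poly.
rewrite -[RHS](cayley_hamilton_sum (rho a)).
rewrite [RHS](big_ord_widen _ (fun i => (char_poly (rho a))`_i *: rho a ^+ i) le_dp).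
rewrite [RHS]big_mkcond; apply: eq_bigr => i _; case: ifP => // /negbT.
rewrite -leqNgt => le_di.
by rewrite nth_default ?scale0r // size_char_poly.
Qed.

End LocalCayleyHamilton.

(** Each of the axioms is an equality in C or in H, which can be checked in the
    localization at every prime and is there a property of matrices. *)
Lemma cayley_hamilton_of_local_bases (k : fieldType) (A : algType k)
    (C : centralSubalg A) d (B : dual_basis (over_csub C)) :
  [pchar k] =i pred0 ->
  (forall P : prime_idealr (csub C), exists t (x : 'I_d -> over_csub C) phi,
     t \notin (P : {pred csub C}) /\ local_basis t x phi) ->
  cayley_hamilton (hattori_stallings B) d.
Proof.
move=> k_char0 loc; set tr := hattori_stallings B.
have tr_eq (a b : csub C) :
    (forall P : prime_idealr (csub C), to_loc P a = to_loc P b) -> a = b.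
  move=> ab; apply/eqP; rewrite -subr_eq0; apply/eqP.
  apply: (@zero_locally _ (csub C)^o) => P.
  rewrite -[LHS]/(to_loc P (a - b)) rmorphB /= ab.
  exact: subrr.
split.
- split=> [c u v|a b].
    rewrite /tr /hattori_stallings scaler_sumr -big_split; apply: eq_bigr => i _.
    transitivity (db_coord i (c *: lmul (u : A) (db_vec i) + lmul (v : A) (db_vec i)));
      last exact: linearP.
    congr (db_coord i _).
    by rewrite [LHS]lmulDl; congr (_ + _); apply/esym/(mulrA (val c : A)).
  apply: tr_eq => P; have [t [x [phi [Pt tB]]]] := loc P.
  by rewrite !(tr_local_rep Pt tB) !(local_repM Pt tB) mxtrace_mulC.
- move=> a; apply: (@zero_locally _ (over_csub C)) => P.
  have [t [x [phi [Pt tB]]]] := loc P; apply: (local_rep_eq0 (Pt := Pt) tB).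
  exact: (rho_cayley_hamilton tB k_char0 (tr_local_rep Pt tB B)).
- apply: tr_eq => P; have [t [x [phi [Pt tB]]]] := loc P.
  by rewrite (tr_local_rep Pt tB) (local_rep1 Pt tB) mxtrace1 rmorph_nat.
Qed.

(** * Sweedler calculus *)

Section TensLift.
Variables (R : comNzRingType) (U V W : lmodType R).

Lemma tens_lift_sum (F : U -> V -> W) I (s : seq I) (X : I -> tensor U V) :
  bilinear_map F ->
  tens_lift F (\sum_(i <- s) X i) = \sum_(i <- s) tens_lift F (X i).
Proof.
move=> F_bilin; exact/linear_fun_sum/tens_lift_linear.
Qed.

Lemma tens_lift_param_linear (T : lmodType R) (F : T -> U -> V -> W) y :
  (forall u v, linear (fun x => F x u v)) -> linear (fun x => tens_lift (F x) y).
Proof.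
move=> F_lin a x x'; rewrite /tens_lift /tens_sum scaler_sumr -big_split.
by apply: eq_bigr => p _; rewrite F_lin.
Qed.

End TensLift.

Section Sweedler.
Variables (k : fieldType) (H : hopfAlgType k).
Implicit Types (W : lmodType k) (h u v : H).

(** sweedler F h is the sum of the F(h_1, h_2). *)
Definition sweedler (W : nmodType) (F : H -> H -> W) h : W :=
  tens_lift F (comul h).

Lemma eq_sweedler (W : nmodType) (F G : H -> H -> W) h :
  (forall u v, F u v = G u v) -> sweedler F h = sweedler G h.
Proof. by move=> FG; apply: eq_bigr => p _. Qed.

Lemma sweedler_sum (W : nmodType) n (F : 'I_n -> H -> H -> W) h :
  sweedler (fun u v => \sum_i F i u v) h = \sum_i sweedler (F i) h.
Proof. exact: exchange_big. Qed.

Lemma linear_sweedler W W' (f : W -> W') (F : H -> H -> W) h : linear f ->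
  f (sweedler F h) = sweedler (fun u v => f (F u v)) h.
Proof.
by move=> f_lin; exact: linear_fun_sum.
Qed.

Section Bilinear.
Variables (W : lmodType k) (F : H -> H -> W).
Hypothesis F_bilin : bilinear_map F.

Lemma sweedler_linear : linear (sweedler F).
Proof. by move=> a x y; rewrite /sweedler linearP tens_lift_linear. Qed.

Lemma sweedler_list I (s : seq I) (f g : I -> H) h :
  comul h = \sum_(p <- s) tens (f p) (g p) ->
  sweedler F h = \sum_(p <- s) F (f p) (g p).
Proof.
move=> hE; rewrite /sweedler hE tens_lift_sum //; apply: eq_bigr => p _.
exact: tens_liftE.
Qed.

Lemma sweedlerM x y :
  sweedler F (x * y) =
  sweedler (fun a b => sweedler (fun u v => F (a * u) (b * v)) y) x.
Proof.
rewrite /sweedler rmorphM /= [LHS](tens_sum_repr _ F_bilin).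
exact: tens_sum_mul.
Qed.

End Bilinear.

Lemma sweedlerA W (F : H -> H -> H -> W) h :
  (forall v w, linear (fun u => F u v w)) ->
  (forall u w, linear (fun v => F u v w)) ->
  (forall u v, linear (F u v)) ->
  sweedler (fun x w => sweedler (fun u v => F u v w) x) h =
  sweedler (fun u y => sweedler (fun v w => F u v w) y) h.
Proof.
move=> F1 F2 F3.
have F_bilin u : bilinear_map (F u) by split.
pose Phi (u : H) y := tens_lift (F u) y.
have Phi_bilin : bilinear_map Phi.
  by split=> [y|u]; [exact: tens_lift_param_linear | exact: tens_lift_linear].
pose K (x : tensor H H) (w : H) : tensor H (tensor H H) :=
  tens_lift (fun u v => tens u (tens v w)) x.
have tB := tens_bilinear.
have K_bilin : bilinear_map K.
  split=> [w|x].
    apply: tens_lift_linear; split=> [v|u]; first by case: (tB k H (tensor H H)).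
    move=> a v v'; rewrite (tB k H H).1; exact: (tB k H (tensor H H)).2.
  apply: tens_lift_param_linear => u v a w w'.
  rewrite (tB k H H).2; exact: (tB k H (tensor H H)).2.
have := congr1 (tens_lift Phi) (comulA h).
rewrite [tens_assoc _](tens_lift_sum _ _ K_bilin) /tens_sum tens_lift_sum //.
rewrite [X in _ = X]tens_lift_sum // => e.
transitivity (\sum_(p <- repr (comul h)) tens_lift Phi (K (comul p.1) p.2)).
  apply: eq_bigr => p _; rewrite /K [X in tens_lift Phi X]/tens_lift /tens_sum.
  rewrite tens_lift_sum //; apply: eq_bigr => q _.
  by rewrite tens_liftE // /Phi tens_liftE.
transitivity (\sum_(p <- repr (comul h)) tens_lift Phi (tens p.1 (comul p.2))).
  rewrite -e; apply: eq_bigr => p _; congr (tens_lift _ _).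
  by rewrite tens_liftE.
by apply: eq_bigr => p _; rewrite tens_liftE.
Qed.

Lemma sweedler_counitl W (L : H -> W) h : linear L ->
  sweedler (fun u v => counit u *: L v) h = L h.
Proof.
move=> L_lin; rewrite -[in RHS](counitl h) -[tens_lift _ _]/(sweedler _ h).
rewrite (linear_sweedler _ _ L_lin).
by apply: eq_sweedler => u v; rewrite (linear_funZ L_lin).
Qed.

(** S(h_1) h_2 (x) h_3 = 1 (x) h. *)
Lemma sweedler_antipodel W (F : H -> H -> W) h : bilinear_map F ->
  sweedler (fun u y => sweedler (fun v w => F (antipode u * v) w) y) h = F 1 h.
Proof.
move=> [F1 F2]; rewrite -(sweedlerA (F := fun u v w => F (antipode u * v) w)).
- transitivity (sweedler (fun x w => counit x *: F 1 w) h).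
    apply: eq_sweedler => x w.
    rewrite -(linear_sweedler (f := F^~ w)) // [sweedler _ x]antipodel.
    exact: (linear_funZ (F1 w)).
  exact: sweedler_counitl.
- by move=> v w a u u'; rewrite linearP mulrDl -scalerAl F1.
- by move=> u w a v v'; rewrite mulrDr -scalerAr F1.
- by move=> u v; apply: F2.
Qed.

(** h_1 S(h_2) (x) h_3 = 1 (x) h. *)
Lemma sweedler_antipoder W (F : H -> H -> W) h : bilinear_map F ->
  sweedler (fun u y => sweedler (fun v w => F (u * antipode v) w) y) h = F 1 h.
Proof.
move=> [F1 F2]; rewrite -(sweedlerA (F := fun u v w => F (u * antipode v) w)).
- transitivity (sweedler (fun x w => counit x *: F 1 w) h).
    apply: eq_sweedler => x w.
    rewrite -(linear_sweedler (f := F^~ w)) // [sweedler _ x]antipoder.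
    exact: (linear_funZ (F1 w)).
  exact: sweedler_counitl.
- by move=> v w a u u'; rewrite mulrDl -scalerAl F1.
- by move=> u w a v v'; rewrite linearP mulrDr -scalerAr F1.
- by move=> u v; apply: F2.
Qed.

End Sweedler.

(** * The Galois map *)

Section CounitCoordinates.
Variables (k : fieldType) (H : hopfAlgType k) (C : centralSubalg H).

Definition counit_csub (c : csub C) : k := counit (val c).

Fact counit_csub_zmod_morphism : zmod_morphism counit_csub.
Proof. by move=> a b; rewrite /counit_csub !rmorphB. Qed.

Fact counit_csub_monoid_morphism : monoid_morphism counit_csub.
Proof.
by split=> [|a b]; rewrite /counit_csub ?rmorph1 ?rmorphM //; apply: rmorph1.
Qed.

HB.instance Definition _ := GRing.isZmodMorphism.Build (csub C) k counit_csub
  counit_csub_zmod_morphism.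
HB.instance Definition _ := GRing.isMonoidMorphism.Build (csub C) k counit_csub
  counit_csub_monoid_morphism.

Lemma counit_csub_alg a : counit_csub a%:A = a.
Proof. by rewrite /counit_csub /= linearZ /= rmorph1 [LHS]mulr1. Qed.

Lemma csub_algE (a : k) (h : H) : val (a%:A : csub C) * h = a *: h.
Proof. by rewrite linearZ /= -scalerAl mul1r. Qed.

(** The y_l form a basis of H / H C+ over k, and the pi_l are its coordinates.  The
    quotient appears only through the linear maps that factor through it, those
    on which C acts by the counit. *)
Definition counit_coordinates d (y : 'I_d -> H) (pi : 'I_d -> H -> k) : Prop :=
  [/\ forall l, linear (pi l : H -> k^o),
      forall l (c : csub C) h, pi l (val c * h) = counit_csub c * pi l h,
      forall l j, pi l (y j) = (l == j)%:R
    & forall (W : lmodType k) (g : H -> W), linear g ->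
        (forall c h, g (val c * h) = counit_csub c *: g h) ->
        forall h, g h = \sum_l pi l h *: g (y l)].

(** Coordinates of H at the counit of C, where the denominator is a nonzero
    element of k and can be divided out. *)
Lemma counit_coordinates_exist : finitely_generated (over_csub C) ->
  exists d (y : 'I_d -> H) pi, counit_coordinates y pi.
Proof.
move=> H_fg.
pose eps : {rmorphism csub C -> k} := counit_csub.
have [|s [d [y [lam co]]]] := @coordinates_exist _ _ eps _ _ H_fg.
  by move=> a b /eqP; rewrite mulf_eq0 => /orP[] /eqP ->; [left | right].
have lam_lin l := coordinates_linear co l.
have [/eqP s0 _ _] := co.
have lamC l (c : csub C) (h : H) : lam l (val c * h) = counit_csub c * lam l h.
  have := lam_lin l c h 0; rewrite [c *: _ + 0]addr0 => ->.
  have := lam_lin l 1 0 0; rewrite scaler0 addr0 /= rmorph1 mul1r => /eqP.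
  by rewrite -subr_eq subrr eq_sym => /eqP ->; rewrite addr0.
have lamD l : {morph lam l : u v / u + v}.
  by move=> u v; have := lam_lin l 1 u v; rewrite scale1r /= rmorph1 mul1r.
exists d, y, (fun l h => (counit_csub s)^-1 * lam l h); split.
- move=> l a u v; rewrite [lam l _]lamD -csub_algE lamC counit_csub_alg mulrDr.
  by rewrite mulrCA.
- by move=> l c h; rewrite lamC mulrCA.
- move=> l j; rewrite (coordinates_gen co) -mulr_natr mulrA mulVf // mul1r.
  by [].
- move=> W g g_lin gC h.
  have g_semi : linear_for (counit_csub \; *:%R) (g : over_csub C -> W).
    by move=> c u v; rewrite [LHS](linear_funD g_lin) [g (c *: u)]gC.
  rewrite -[LHS](scalerK s0) (coordinates_expand co g_semi) scaler_sumr.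
  by apply: eq_bigr => l _; rewrite scalerA.
Qed.

End CounitCoordinates.

Section Galois.
Variables (k : fieldType) (H : hopfAlgType k) (C : centralSubalg H).
Hypothesis C_hopf : hopf_subalgebra C.
Variables (d : nat) (y : 'I_d -> H) (pi : 'I_d -> H -> k).
Hypothesis pi_coord : counit_coordinates C y pi.

(** The j-th component of the Galois map b |-> b_1 (x) [b_2] in H (x) H / H C+. *)
Definition galois_coord j (h : H) : H := sweedler (fun u v => pi j v *: u) h.

Let pi_lin l : linear (pi l : H -> k^o). Proof. by case: pi_coord. Qed.

Lemma galois_bilinear j : bilinear_map (fun u v : H => pi j v *: u).
Proof.
split=> [v|u] a w w'; first by rewrite scalerDr !scalerA mulrC.
by rewrite pi_lin scalerDl scalerA.
Qed.

Lemma galois_coord_linear j : linear (galois_coord j).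
Proof. exact/sweedler_linear/galois_bilinear. Qed.

Lemma csub_central (c : csub C) (h : H) : h * val c = val c * h.
Proof. exact/esym/(central_subproof (s := C))/valP. Qed.

(** (c b)_1 pi((c b)_2) = c_1 b_1 eps(c_2) pi(b_2), as the second tensor factor of
    the coproduct of c stays in C. *)
Lemma galois_coordC j (c : csub C) h :
  galois_coord j (val c * h) = val c * galois_coord j h.
Proof.
have [s cE] := C_hopf.1 c; have [_ piC _ _] := pi_coord.
rewrite /galois_coord sweedlerM; last exact: galois_bilinear.
rewrite (sweedler_list _ cE); last first.
  split=> [v|u] a w w'.
    rewrite /sweedler /tens_lift /tens_sum scaler_sumr -big_split.
    apply: eq_bigr => q _; rewrite mulrDl scalerDr -scalerAl !scalerA.
    by rewrite [_ * a]mulrC.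
  rewrite /sweedler /tens_lift /tens_sum scaler_sumr -big_split.
  by apply: eq_bigr => q _; rewrite mulrDl -scalerAl pi_lin scalerDl scalerA.
have -> : val c = \sum_(p <- s) counit_csub p.2 *: val p.1.
  rewrite -[LHS]counitr -[tens_lift _ _]/(sweedler _ _).
  rewrite (sweedler_list _ cE) //.
  split=> [v|u] a w w'; first by rewrite scalerDr !scalerA mulrC.
  by rewrite linearP scalerDl scalerA.
rewrite mulr_suml; apply: eq_bigr => p _.
rewrite /sweedler /tens_lift /tens_sum mulr_sumr.
apply: eq_bigr => q _; rewrite piC -scalerAl -scalerAr scalerA.
by [].
Qed.

(** With h = y_l, the value is 1 for j = l and 0 otherwise: the tensor
    S(h_1) (x) h_2 is a preimage of the l-th unit vector of H^d. *)
Lemma galois_coord_surj j h :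
  sweedler (fun u v => antipode u * galois_coord j v) h = (pi j h)%:A.
Proof.
transitivity (sweedler (fun u x => sweedler (fun v w =>
    pi j w *: (antipode u * v)) x) h).
  apply: eq_sweedler => u x; rewrite /galois_coord.
  rewrite (linear_sweedler (f := *%R (antipode u))).
    by apply: eq_sweedler => v w; rewrite scalerAr.
  by move=> a v v'; rewrite mulrDr scalerAr.
rewrite (sweedler_antipodel (F := fun v w => pi j w *: v)) //.
exact: galois_bilinear.
Qed.

End Galois.

(** * Relations between d generators *)

Lemma finitely_generated_fin (R : comNzRingType) (M : lmodType R) (I : finType)
    (z : I -> M) :
  (forall m, exists c : I -> R, m = \sum_i c i *: z i) -> finitely_generated M.
Proof.
move=> gen; exists #|I|, (fun i => z (enum_val i)) => m.
have [c ->] := gen m; exists (fun i => c (enum_val i)).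
by rewrite (reindex _ (onW_bij _ (enum_val_bij I))).
Qed.

Lemma finitely_generated_ffun (R : comNzRingType) (M : lmodType R) d :
  finitely_generated M -> finitely_generated {ffun 'I_d -> M}.
Proof.
move=> [n [z gen]].
apply: (@finitely_generated_fin _ _ ('I_d * 'I_n)%type
  (fun p => [ffun j => if j == p.1 then z p.2 else 0])) => v.
have /choice[c cE] i : exists c : 'I_n -> R, v i = \sum_l c l *: z l.
  exact: gen.
exists (fun p => c p.1 p.2); apply/ffunP => j.
pose e i l : {ffun 'I_d -> M} := [ffun j => if j == i then z l else 0].
rewrite -(pair_bigA _ (fun i l => c i l *: e i l)) /= sum_ffunE.
have eE i : (\sum_l c i l *: e i l) j = if j == i then v i else 0.
  rewrite sum_ffunE; under eq_bigr => l _ do rewrite !ffunE.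
  by case: eqP => [_|_]; rewrite ?cE // big1 // => l _; apply: scaler0.
under eq_bigr => i _ do rewrite eE.
by rewrite (bigD1 j) //= eqxx big1 ?addr0 // => i; rewrite eq_sym => /negPf ->.
Qed.

Section RelationsAreTorsion.
Variables (k : fieldType) (H : hopfAlgType k) (C : centralSubalg H).
Hypothesis C_hopf : hopf_subalgebra C.
Variables (d : nat) (y : 'I_d -> H) (pi : 'I_d -> H -> k).
Hypothesis pi_coord : counit_coordinates C y pi.
Hypothesis H_fg : finitely_generated (over_csub C).
Local Notation M := (over_csub C).
Local Notation gamma := (galois_coord pi).

Let gamma_semi j : linear (gamma j : M -> M).
Proof.
move=> c u v; have := galois_coord_linear pi_coord j 1 (c *: u) v.
by rewrite !scale1r => ->; rewrite (galois_coordC C_hopf pi_coord).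
Qed.

Lemma galois_coord_sum j n (c : 'I_n -> csub C) (x : 'I_n -> M) :
  gamma j (\sum_i c i *: x i : M) = \sum_i val (c i) * gamma j (x i).
Proof.
rewrite [LHS](linear_fun_sum (gamma_semi j)); apply: eq_bigr => i _.
exact: galois_coordC pi_coord _ _ _.
Qed.

(** Let f be the composite H^d -> H (x)_C H -> H^d, v |-> sum_i v_i (x) x_i
    followed by the Galois map.  Its image contains s H^d: a preimage of v under
    the Galois map has second factors b, and s b is a combination of the x_i.
    So f is injective up to a power of s, while it kills (c_i 1)_i as soon as
    sum c_i x_i = 0, the gamma_j being C-linear. *)
Lemma relations_torsion (s : csub C) (x : 'I_d -> M) :
  generates_away s x ->
  exists N, forall c : 'I_d -> csub C,
    \sum_i c i *: x i = 0 -> forall i, s ^+ N * c i = 0.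
Proof.
move=> gen; pose V := {ffun 'I_d -> M}.
pose f (v : V) : V := [ffun j => (\sum_i (v i : H) * gamma j (x i) : H)].
have f_lin : linear f.
  move=> a v w; apply/ffunP => j; rewrite !ffunE.
  rewrite [RHS](_ : _ = val a * (\sum_i (v i : H) * gamma j (x i)) +
    \sum_i (w i : H) * gamma j (x i)) //.
  rewrite mulr_sumr -big_split; apply: eq_bigr => i _ /=.
  rewrite !ffunE mulrA -mulrDl; congr (_ * _).
pose iL := GRing.isLinear.Build (csub C) V V *:%R f f_lin.
pose fl : {linear V -> V} := HB.pack f iL.
have f_surj v : exists w, s *: v = fl w.
  have /choice[c cE] h : exists c : 'I_d -> csub C, s *: (h : M) = \sum_i c i *: x i.
    exact: gen.
  exists [ffun i => (\sum_l (v l : H) *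
    sweedler (fun a b => antipode a * val (c b i)) (y l) : H)].
  apply/ffunP => j; rewrite !ffunE.
  have [_ _ pi_y _] := pi_coord.
  have surj_j : (v j : H) = \sum_l (v l : H) *
      sweedler (fun a b => antipode a * gamma j b) (y l).
    under eq_bigr => l _ do
      rewrite (galois_coord_surj pi_coord) pi_y -scalerAr mulr1.
    rewrite (bigD1 j) //= eqxx scale1r big1 ?addr0 // => l.
    by rewrite eq_sym => /negPf ->; rewrite scale0r.
  rewrite [LHS](_ : _ = val s * (v j : H)) // surj_j mulr_sumr.
  under [RHS]eq_bigr => i _ do rewrite ffunE mulr_suml.
  rewrite [RHS]exchange_big; apply: eq_bigr => l _ /=.
  rewrite mulrA -csub_central -mulrA.
  under [RHS]eq_bigr => i _ do rewrite -mulrA.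
  rewrite -mulr_sumr; congr (_ * _).
  rewrite /sweedler /tens_lift /tens_sum mulr_sumr.
  under [RHS]eq_bigr => i _ do rewrite mulr_suml.
  rewrite [RHS]exchange_big; apply: eq_bigr => p _ /=.
  rewrite mulrA -csub_central -mulrA -(galois_coordC C_hopf pi_coord).
  rewrite -[val s * p.2]/(s *: (p.2 : M)) cE galois_coord_sum mulr_sumr.
  by apply: eq_bigr => i _; rewrite mulrA.
have V_fg := finitely_generated_ffun d H_fg.
have [N N_tors] := near_surjective_near_injective V_fg f_surj.
exists N => c rel i; apply: val_inj.
pose v : V := [ffun i => val (c i)].
have /N_tors/ffunP/(_ i) : fl v = 0.
  apply/ffunP => j; rewrite !ffunE.
  under eq_bigr => l _ do rewrite ffunE.
  rewrite -galois_coord_sum rel.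
  exact: (linear_fun0 (gamma_semi j)).
by rewrite !ffunE.
Qed.

End RelationsAreTorsion.

(** * The bound on the local rank *)

(** Q as a k-module through k -> C -> Q; chi is a parameter of the type so that
    the instance can depend on it. *)
Definition char_module (k : fieldType) (A : algType k) (C : centralSubalg A)
  (Q : comNzRingType) (chi : csub C -> Q) : Type := Q.

Section CharModule.
Variables (k : fieldType) (A : algType k) (C : centralSubalg A).
Variables (Q : comNzRingType) (chi : {rmorphism csub C -> Q}).

HB.instance Definition _ := GRing.Zmodule.on (char_module chi).

Definition char_scale (a : k) (q : char_module chi) : char_module chi :=
  (chi a%:A * (q : Q) : Q).

Fact char_scaleA a b q : char_scale a (char_scale b q) = char_scale (a * b) q.
Proof. by rewrite /char_scale mulrA -rmorphM -scalerAl mul1r scalerA. Qed.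
Fact char_scale1 : left_id 1 char_scale.
Proof. by move=> q; rewrite /char_scale scale1r rmorph1 mul1r. Qed.
Fact char_scaleDr : right_distributive char_scale +%R.
Proof. by move=> a p q; apply: (@mulrDr Q). Qed.
Fact char_scaleDl q : {morph char_scale^~ q : a b / a + b}.
Proof.
move=> a b; rewrite /char_scale scalerDl rmorphD; exact: (@mulrDl Q).
Qed.

HB.instance Definition _ := GRing.Zmodule_isLmodule.Build k (char_module chi)
  char_scaleA char_scale1 char_scaleDr char_scaleDl.

End CharModule.

Section BalancedMaps.
Variables (k : fieldType) (H : hopfAlgType k) (C : centralSubalg H).
Hypothesis C_hopf : hopf_subalgebra C.
Variables (W : lmodType k) (B : H -> H -> W).
Hypothesis B_bilin : bilinear_map B.
Hypothesis B_balanced :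
  forall (c : csub C) a b, B (val c * a) b = B a (val c * b).

(** The form that corresponds to B under the Galois map, which is inverted by
    x (x) h |-> x S(h_1) (x) h_2. *)
Definition twisted (x h : H) : W :=
  sweedler (fun u v => B (x * antipode u) v) h.

Let B1 b : linear (B^~ b). Proof. exact: B_bilin.1. Qed.
Let B2 a : linear (B a). Proof. exact: B_bilin.2. Qed.

Lemma twisted_bilinear : bilinear_map twisted.
Proof.
split=> [h|x].
  by apply: tens_lift_param_linear => u v a x x'; rewrite mulrDl -scalerAl B1.
apply: sweedler_linear; split=> [v|u]; last exact: B2.
by move=> a u u'; rewrite linearP mulrDr -scalerAr B1.
Qed.

Lemma untwist a b : B a b = sweedler (fun u v => twisted (a * u) v) b.
Proof.
rewrite -[a in LHS]mulr1 -(sweedler_antipoder (F := fun u v => B (a * u) v)).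
  by apply: eq_sweedler => u v; apply: eq_sweedler => p q; rewrite mulrA.
split=> [v|u]; last exact: B2.
by move=> t u u'; rewrite mulrDr -scalerAr B1.
Qed.

(** In its second argument the transported form factors through H / H C+.
    Indeed eps(c) twisted(x, h) = B(x S(h_1) S(c_1) c_2, h_2)
    = B(x S(h_1) S(c_1), c_2 h_2), since B is balanced and c_2 lies in C; here B
    is rewritten through [untwist], giving
    twisted(x S(h_1) S(c_1) c_2 h_2, c_3 h_3), where the antipodes cancel. *)
Lemma twistedC x (c : csub C) h :
  twisted x (val c * h) = counit_csub c *: twisted x h.
Proof.
have [s cE] := C_hopf.1 c.
have [T1 T2] := twisted_bilinear.
have T1Z r t v : twisted (t *: r) v = t *: twisted r v.
  exact: (linear_funZ (T1 v)).
have epsE : (counit_csub c)%:A = \sum_(p <- s) antipode (val p.1) * val p.2.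
  rewrite -[LHS]antipodel -[tens_lift _ _]/(sweedler _ _).
  rewrite (sweedler_list _ cE) //; split=> [v|u] t w w'.
    by rewrite linearP mulrDl -scalerAl.
  by rewrite mulrDr -scalerAr.
rewrite -T1Z {2}/twisted.
transitivity (sweedler (fun u v =>
    \sum_(p <- s) B (x * antipode u * antipode (val p.1)) (val p.2 * v)) h); last first.
  apply: eq_sweedler => u v.
  have -> : (counit_csub c *: x) * antipode u = x * antipode u * (counit_csub c)%:A.
    by rewrite -scalerAl -scalerAr mulr1.
  rewrite epsE mulr_sumr (linear_fun_sum (B1 v)); apply: eq_bigr => p _.
  by rewrite mulrA csub_central B_balanced.
rewrite -[x in LHS]mulr1.
have F_bilin (z v1 v2 : H) : bilinear_map (fun r w => twisted (z * r * v1) (w * v2)).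
  split=> [w|r] t a a'; last by rewrite mulrDl -scalerAl T2.
  by rewrite mulrDr mulrDl -scalerAr -scalerAl T1.
rewrite -(sweedler_antipodel (F := fun r w => twisted (x * r) (val c * w))); last first.
  split=> [w|r] t a a'; last by rewrite mulrDr -scalerAr T2.
  by rewrite mulrDr -scalerAr T1.
apply: eq_sweedler => u v.
transitivity (sweedler (fun v1 v2 => \sum_(p <- s) sweedler (fun q1 q2 =>
    twisted (x * antipode u * (antipode (val p.1) * q1) * v1) (q2 * v2)) (val p.2)) v).
  apply: eq_sweedler => v1 v2.
  transitivity (sweedler (fun r w => sweedler (fun q1 q2 =>
      twisted (x * antipode u * (antipode r * q1) * v1) (q2 * v2)) w) (val c)).
    rewrite (sweedler_antipodel (F := fun r w =>
      twisted (x * antipode u * r * v1) (w * v2))) //.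
    by rewrite mulr1 mulrA.
  rewrite (sweedler_list _ cE) //; split=> [w|r] t a a'.
    rewrite /sweedler /tens_lift /tens_sum scaler_sumr -big_split.
    apply: eq_bigr => q _; rewrite linearP mulrDl -scalerAl.
    exact: (F_bilin _ _ _).1.
  apply: sweedler_linear; split=> [w'|q] t' b b'.
    by rewrite !mulrDr mulrDl -!scalerAr -scalerAl T1.
  by rewrite mulrDl -scalerAl T2.
transitivity (\sum_(p <- s) sweedler (fun q1 q2 => sweedler (fun v1 v2 =>
    twisted (x * antipode u * (antipode (val p.1) * q1) * v1) (q2 * v2)) v) (val p.2)).
  rewrite [LHS]exchange_big; apply: eq_bigr => p _; exact: exchange_big.
apply: eq_bigr => p _; rewrite untwist sweedlerM.
  apply: eq_sweedler => q1 q2; apply: eq_sweedler => v1 v2.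
  by rewrite !mulrA.
split=> [w|r] t a a'; last exact: T2.
by rewrite mulrDr -scalerAr T1.
Qed.

Lemma balanced_coordinates d (y : 'I_d -> H) (pi : 'I_d -> H -> k) a b :
  counit_coordinates C y pi ->
  B a b = \sum_l twisted (a * galois_coord pi l b) (y l).
Proof.
move=> [_ _ _ pi_expand]; have [T1 T2] := twisted_bilinear.
transitivity (sweedler (fun u v =>
    \sum_l pi l v *: twisted (a * u) (y l)) b).
  rewrite untwist; apply: eq_sweedler => u v.
  apply: pi_expand; [exact: T2 | move=> c h; exact: twistedC].
rewrite sweedler_sum; apply: eq_bigr => l _.
have T_lin : linear (fun u => twisted (a * u) (y l)).
  by move=> t u u'; rewrite mulrDr -scalerAr T1.
rewrite [RHS](linear_fun_sum T_lin); apply: eq_bigr => p _.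
by rewrite (linear_funZ T_lin).
Qed.

End BalancedMaps.

Lemma domain_expf_eq0 (Q : comNzRingType) (q : Q) m :
  (forall a b : Q, a * b = 0 -> a = 0 \/ b = 0) -> q ^+ m = 0 -> q = 0.
Proof.
move=> Q_dom; elim: m => [|m IHm]; last by rewrite exprS => /Q_dom[] // /IHm.
by rewrite expr0 => /eqP; rewrite oner_eq0.
Qed.

Section RankBound.
Variables (k : fieldType) (H : hopfAlgType k) (C : centralSubalg H).
Hypothesis C_hopf : hopf_subalgebra C.
Variables (Q : comNzRingType) (chi : {rmorphism csub C -> Q}).
Hypothesis Q_dom : forall a b : Q, a * b = 0 -> a = 0 \/ b = 0.
Variables (s : csub C) (n : nat) (e : 'I_n -> over_csub C).
Variable lam : 'I_n -> over_csub C -> Q.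
Hypothesis co : coordinates_at chi s e lam.
Local Notation M := (over_csub C).

Let lamD i : {morph lam i : u v / u + v}.
Proof.
by move=> u v; have := coordinates_linear co i 1 u v; rewrite scale1r /= rmorph1 mul1r.
Qed.

Let lamC i (c : csub C) (h : H) : lam i (val c * h) = chi c * lam i h.
Proof.
have lam0 : lam i 0 = 0.
  by have /eqP := lamD i 0 0; rewrite addr0 -subr_eq subrr => /eqP.
by have := coordinates_linear co i c h 0; rewrite lam0 !addr0.
Qed.

Definition coord_product i j (a b : H) : char_module chi := lam i a * lam j b.

Lemma coord_product_bilinear i j : bilinear_map (coord_product i j).
Proof.
split=> [b|a] t u u'; rewrite /coord_product.
  rewrite [lam i _]lamD -(csub_algE C) lamC mulrDl -mulrA; reflexivity.
rewrite [lam j _]lamD -(csub_algE C) lamC mulrDr mulrCA; reflexivity.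
Qed.

Lemma coord_product_balanced i j (c : csub C) a b :
  coord_product i j (val c * a) b = coord_product i j a (val c * b).
Proof. by rewrite /coord_product !lamC mulrCA mulrA. Qed.

Lemma twisted_semilinear i j h :
  linear_for (chi \; *%R) ((fun x => twisted (coord_product i j) x h) : M -> Q).
Proof.
have [T1 _] := twisted_bilinear (coord_product_bilinear i j).
move=> c u v; have := T1 h 1 (c *: u : M) v; rewrite !scale1r => -> /=.
congr (_ + _); rewrite [RHS]mulr_sumr; apply: eq_bigr => p _.
by rewrite /coord_product -[(c *: u) * _]mulrA lamC mulrA.
Qed.

(** The form lam_i(a) lam_j(b) is C-balanced, so its values on the pairs
    (e_p, e_q), which form an invertible diagonal matrix of size n * n once
    chi s is inverted, are computed through the d * n values of the transported
    form on the pairs (e_m, y_l).  Hence n * n <= d * n. *)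
Lemma local_rank_le d (y : 'I_d -> H) (pi : 'I_d -> H -> k) :
  counit_coordinates C y pi -> (n <= d)%N.
Proof.
move=> pi_coord; rewrite leqNgt; apply/negP => lt_dn.
pose I := ('I_n * 'I_n)%type; pose J := ('I_d * 'I_n)%type.
pose A : 'M[Q]_(#|{: I}|, #|{: J}|) := \matrix_(r, c)
  lam (enum_val c).2
    (e (enum_val r).1 * galois_coord pi (enum_val c).1 (e (enum_val r).2) : H).
pose D : 'M[Q]_(#|{: J}|, #|{: I}|) := \matrix_(c, r)
  twisted (coord_product (enum_val r).1 (enum_val r).2) (e (enum_val c).2)
    (y (enum_val c).1).
(* One factor chi s for each of the two forms, and one for the expansion on e. *)
have AD : A *m D = (chi s ^+ 3)%:M.
  apply/matrixP => r r'; rewrite !mxE -(inj_eq enum_val_inj).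
  under eq_bigr => c _ do rewrite !mxE.
  case: (enum_val r) (enum_val r') => [p q] [i j] /=.
  pose G (x h : H) : Q := twisted (coord_product i j) x h.
  transitivity (\sum_l \sum_m
      lam m (e p * galois_coord pi l (e q) : H) * G (e m) (y l)).
    rewrite pair_bigA /=.
    by rewrite [RHS](reindex _ (onW_bij _ (enum_val_bij J))).
  transitivity (chi s * (lam i (e p) * lam j (e q))).
    have -> : lam i (e p) * lam j (e q) =
        \sum_l G (e p * galois_coord pi l (e q)) (y l).
      exact: (balanced_coordinates C_hopf (coord_product_bilinear i j)
        (coord_product_balanced i j) _ _ pi_coord).
    rewrite mulr_sumr; apply: eq_bigr => l _.
    exact/esym/(coordinates_expand (W := Q^o) co (twisted_semilinear i j (y l))).
  rewrite !(coordinates_gen co) xpair_eqE ![_ == p]eq_sym ![_ == q]eq_sym.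
  by case: eqP; case: eqP => _ _;
    rewrite /= ?mulr0n ?mulr0 ?mul0r ?mulr0 // !mulr1n !exprS expr0 mulr1.
have [s0 _ _] := co; apply: s0.
have : \det (A *m D) = 0.
  apply: det_mulmx_small; rewrite !card_prod !card_ord ltn_mul2r lt_dn andbT.
  exact: leq_trans lt_dn.
by rewrite AD det_scalar => /(domain_expf_eq0 Q_dom)/(domain_expf_eq0 Q_dom).
Qed.

End RankBound.

(** * Projectivity and the Cayley-Hamilton property *)

Lemma generates_away_pad (R : comNzRingType) (M : lmodType R) (s : R) n d
    (e : 'I_n -> M) :
  (n <= d)%N -> generates_away s e -> exists x : 'I_d -> M, generates_away s x.
Proof.
move=> le_nd gen; have def_d := subnKC le_nd; rewrite -def_d {le_nd def_d}.
exists (fun i => if split i is inl j then e j else 0) => m.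
have [c ->] := gen m.
exists (fun i => if split i is inl j then c j else 0).
rewrite big_split_ord /= [X in _ = _ + X]big1 ?addr0 => [|i _].
  by apply: eq_bigr => i _; rewrite (unsplitK (inl i)).
by rewrite (unsplitK (inr i)) scaler0.
Qed.

Lemma prime_expf (R : comNzRingType) (P : prime_idealr R) s N :
  s \notin (P : {pred R}) -> s ^+ N \notin (P : {pred R}).
Proof.
move=> Ps; elim: N => [|N IHN]; first by rewrite expr0 idealr1.
by rewrite exprS prime_idealrM negb_or Ps.
Qed.

(** H is locally free over C, with a rank that is read off at the counit. *)
Lemma hopf_local_bases (k : fieldType) (H : hopfAlgType k)
    (C : centralSubalg H) :
  hopf_subalgebra C -> finitely_generated (over_csub C) ->
  exists d, forall P : prime_idealr (csub C),
    exists t (x : 'I_d -> over_csub C) phi,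
      t \notin (P : {pred csub C}) /\ local_basis t x phi.
Proof.
move=> C_hopf H_fg.
have [d [y [pi pi_coord]]] := counit_coordinates_exist H_fg; exists d => P.
pose Q : comNzRingType := {ideal_quot P}.
pose chi : {rmorphism csub C -> Q} := \pi_Q%qT.
have Q_dom (a b : Q) : a * b = 0 -> a = 0 \/ b = 0.
  by move=> /Quotient.rquot_IdomainAxiom/orP[] /eqP; [left | right].
have [s [n [e [lam co]]]] := coordinates_exist chi Q_dom H_fg.
have le_nd := local_rank_le C_hopf Q_dom co pi_coord.
have [s0 gen _] := co.
have Ps : s \notin (P : {pred csub C}).
  apply/negP => sP; apply: s0; apply/eqP.
  by rewrite -(rmorph0 chi) -Quotient.idealrBE subr0.
have [x gen_x] := generates_away_pad le_nd gen.
have [N tors] := relations_torsion C_hopf pi_coord H_fg gen_x.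
have [phi tB] := local_basis_of_generators gen_x tors.
by exists (s ^+ N.+1), x, phi; split; first exact: prime_expf.
Qed.

Theorem theorem0p1 (k : closedFieldType) (k_char0 : [pchar k] =i pred0)
    (H : hopfAlgType k) (H_affine : affine_algebra H)
    (C : centralSubalg H) (C_hopf : hopf_subalgebra C)
    (H_fg : finitely_generated (over_csub C)) :
  exists d : nat,
    [/\ finitely_generated (over_csub C),
        projective (over_csub C),
        constant_rank (over_csub C) d
      & forall B : dual_basis (over_csub C),
          cayley_hamilton_hopf (hattori_stallings B) d].
Proof.
have [d loc] := hopf_local_bases C_hopf H_fg; exists d; split=> //.
- have [//|B] := @dual_basis_local_global _ (over_csub C); last first.
    exact: dual_basis_projective.
  by move=> P; exists d; apply: loc.
- move=> P; have [t [x [phi [Pt tB]]]] := loc P.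
  exact: localization_free Pt tB.
- move=> B; split=> //; exact: cayley_hamilton_of_local_bases.
Qed.
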